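(* Let $G=(V,E)$ be an undirected graph with $n=|V|$ nodes, $m$ edges and all degrees at least $1$, let $\alpha\in(0,1)$ be a constant and $\varepsilon_d>0$, and let the source $s$ be chosen at random with $\Pr[s=v]=d(v)/(2m)$ for each $v\in V$. Then the averaged per-source lower bound $\sum_{s\in V}\frac{d(s)}{2m}\cdot\frac{1}{\varepsilon_d}\sum_{t\in V}\frac{\pi(s,t)}{d(t)}$ equals $\Theta\!\left(\frac{1}{\varepsilon_d}\cdot\frac nm\right)$, and the expected running time of Algorithm D (described in the context), excluding the one-time $\Theta(m)$ preprocessing of RBS, averaged over this choice of $s$, is $\widetilde O\!\left(\frac{1}{\varepsilon_d}\sqrt{\frac nm}\right)$.
   Context: $d(v)$ is the degree of $v$ (so $\sum_v d(v)=2m$), $\mathcal N(v)$ its neighbor set. $\widetilde O(\cdot)$ suppresses $\mathrm{polylog}(n)$ factors. An $\alpha$-discounted random walk from $u$ terminates at its current node with probability $\alpha$ before each step and otherwise moves to a uniformly random neighbor; $\pi(u,v)$ is the probability that it terminates at $v$; $\pi(t)=\frac1n\sum_{v}\pi(v,t)$. Monte Carlo estimates with $k$ walks: simulate $k$ independent such walks from $s$ and estimate $\pi(s,v)$ by the fraction terminating at $v$. RBS is a randomized subroutine $\mathrm{RBS}(G,\alpha,t,\varepsilon_r,\delta,p_f)$ returning estimates $\pi'(v,t)$, $v\in V$, such that with probability at least $1-p_f$: $|\pi'(v,t)-\pi(v,t)|\le\varepsilon_r\pi(v,t)$ for all $v$ with $\pi(v,t)\ge\delta$, and $\pi'(v,t)\le\pi(v,t)+\delta$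 for all $v$ with $\pi(v,t)<\delta$; for constant $\varepsilon_r$ it runs in expected $\widetilde O(n\pi(t)/\delta)$ time after a $\Theta(m)$ preprocessing (assumed done). BackwardPush$(t,r_{\max})$: set $q(v,t)=0$ for all $v$, $r(t,t)=1$, $r(v,t)=0$ for $v\ne t$; while some $v$ has $r(v,t)>r_{\max}$, pick any such $v$, add $(1-\alpha)r(v,t)/d(u)$ to $r(u,t)$ for each $u\in\mathcal N(v)$, then add $\alpha r(v,t)$ to $q(v,t)$ and set $r(v,t)=0$; return $q,r$ (stored sparsely). Algorithm D (input $G,\alpha,s,\varepsilon_d$). Phase I: $\pi'(v,s)\leftarrow\mathrm{RBS}(G,\alpha,s,\frac12,\frac14\varepsilon_d d(s),1/n^2)$; $\pi'(s,v)=\pi'(v,s)d(v)/d(s)$ for $v$ with $\pi'(v,s)\ne0$ (else $0$); $C=\{t:\pi'(s,t)/d(t)>\frac12\varepsilon_d\}$. Phase II: $n_r=\lceil n/\varepsilon_d\rceil$, $n_t=\lceil 18\ln(2n^2)\rceil$, $r_{\max}(t)=d(t)^2\varepsilon_d^2 n_r/(6\pi'(s,t))$ for $t\in C$. Repeat: for each $t\in C$ run BackwardPush$(t,\frac12 r_{\max}(t))$, but as soon as the total cost of Backward Push in the current repetition exceeds the expected cost of simulating $n_t\cdot\frac12 n_r$ random walks, abort and leave the loop; if all $t\in C$ complete, set $n_r=\lfloor n_r/2\rfloor$, $r_{\max}(t)=\frac12 r_{\max}(t)$ for all $t\in C$, and repeat. After leaving the loop, run BackwardPush$(t,r_{\max}(t))$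 with the current values for each $t\in C$. Phase III: for $i=1,\dots,n_t$, independently compute Monte Carlo estimates $\pi''_i(s,v)$ with $n_r$ walks and set $\hat\pi_i(s,t)=q(s,t)+\sum_{v:\,r(v,t)\ne0}\pi''_i(s,v)r(v,t)$ for $t\in C$. Output the $\lceil n_t/2\rceil$-th smallest of $\hat\pi_1(s,t),\dots,\hat\pi_{n_t}(s,t)$ for $t\in C$ and $0$ for $t\notin C$. Safeguard: once the actual cost reaches $\Theta(n^2)$, the algorithm switches to the power method, solving the query in $\widetilde O(n^2)$ time.
   Formalization: Running-time bounds Õ(f) are read as Õ(max(1,f)), since any run takes at least one step while f may tend to 0; if C is empty, Algorithm D stops (the loop would never end); Backward Push picks nodes by an arbitrary fixed rule on t and the history of nodes above the threshold. *)

(* Defs.v *)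
From HB Require Import structures.
From mathcomp Require Import all_boot all_order all_algebra.
From mathcomp Require Import all_classical all_reals all_analysis.
Import Order.TTheory GRing.Theory Num.Theory.

Set Implicit Arguments.
Unset Strict Implicit.
Unset Printing Implicit Defensive.

Local Open Scope classical_set_scope.
Local Open Scope ring_scope.

Record ugraph := UGraph {
  vertex :> finType;
  adj : rel vertex;
  adj_sym : symmetric adj;
  adj_irr : irreflexive adj;
  adj_no_isolated : forall v, exists u, adj v u
}.

Section Graph.
Variable G : ugraph.

Definition order_of : nat := #|G|.

Definition edges : {set {set G}} :=
  [set [set e.1; e.2]%SET | e : G * G & adj e.1 e.2]%SET.

Definition size_of : nat := #|edges|.

Definition deg (v : G) : nat := #|[set u | adj v u]%SET|.

End Graph.

(* Running times count unit steps, so a bound O~(f) on a running time is read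
   as O~(max(1, f)): f itself may tend to 0 (e.g. sqrt(n/m) on dense graphs). *)
Definition soft_bound (R : realType) (K : R) (k n : nat) (f : R) : R :=
  K * ln n%:R ^+ k * Num.max 1 f.

(* For x >= 0. *)
Definition natceil (R : realType) (x : R) : nat := `|Num.ceil x|%N.

Section Walks.
Variables (R : realType) (alpha : R) (G : ugraph).

(* A terminated walk from u is encoded by the sequence p of nodes visited after
   u; walk_prob u p is the probability that the walk follows p, then stops. *)
Fixpoint walk_prob (u : G) (p : seq G) : R :=
  if p is v :: p' then
    (1 - alpha) * ((adj u v)%:R / (deg u)%:R) * walk_prob v p'
  else alpha.

Definition ppr (u v : G) : R :=
  fine (\esum_(p in [set p | last u p = v]) (walk_prob u p)%:E).

Definition pagerank (t : G) : R := (order_of G)%:R^-1 * \sum_(v : G) ppr v t.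

(* One unit per termination test. *)
Definition walk_cost (p : seq G) : nat := (size p).+1.

Definition mean_walk_cost (s : G) : R :=
  fine (\esum_(p in [set: seq G]) (walk_prob s p * (walk_cost p)%:R)%:E).

(* Probability of a family of independent walks from s. *)
Definition batch_prob (s : G) (I : finType) (ws : {ffun I -> seq G}) : R :=
  \prod_(i : I) walk_prob s (ws i).

End Walks.

Section BackwardPush.
Variables (R : realType) (alpha : R) (G : ugraph).

Record push_result := PushResult {
  reserve : G -> R;
  residue : G -> R;
  push_cost : nat
}.

Definition active (theta : R) (r : G -> R) : {set G} :=
  [set v | theta < r v]%SET.

(* The rule resolving "pick any such v": for target t, the set of nodes whose
   residue currently exceeds the threshold, and the list of the earlier such
   sets (latest first), it returns the next node to push. *)
Definition push_rule := G -> {set G} -> seq {set G} -> G.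

Definition push_rule_ok (pick : push_rule) : Prop :=
  forall t A h, A != finset.set0 -> pick t A h \in A.

Variable pick : push_rule.

(* A push at v costs one unit per neighbor and one for the reserve of v. *)
Definition push (v : G) (x : push_result) : push_result :=
  let q := reserve x in let r := residue x in
  PushResult
    (fun u => if u == v then q u + alpha * r v else q u)
    (fun u => if u == v then 0
              else if adj v u then r u + (1 - alpha) * r v / (deg u)%:R
              else r u)
    (push_cost x + (deg v).+1).

Fixpoint push_loop (fuel : nat) (t : G) (theta : R) (h : seq {set G})
    (x : push_result) : push_result :=
  let A := active theta (residue x) in
  if A == finset.set0 then x
  else if fuel is fuel'.+1 then
    push_loop fuel' t theta (A :: h) (push (pick t A h) x)
  else x.

(* Every push decreases \sum_u deg u * residue u, which is initially deg t, by
   more than alpha * theta; see push_fuel_enough. *)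
Definition push_fuel (t : G) (theta : R) : nat :=
  (Num.truncn ((deg t)%:R / (alpha * theta))).+1.

Definition push_init (t : G) : push_result :=
  PushResult (fun=> 0) (fun v => (v == t)%:R) 1.

Definition backward_push (t : G) (theta : R) : push_result :=
  push_loop (push_fuel t theta) t theta [::] (push_init t).

End BackwardPush.

(* Estimates together with the number of unit steps spent. *)
Definition outcome (R : realType) (G : ugraph) : Type := ((G -> R) * nat)%type.

Definition nnz (R : realType) (G : ugraph) (f : G -> R) : nat :=
  #|[set v | f v != 0]%SET|.

(* RBS(G, alpha, t, eps_r, delta, p_f), run on the random seed w : Omega. *)
Definition rbs_routine (R : realType) (Omega : Type) : Type :=
  forall G : ugraph, R -> G -> R -> R -> R -> Omega -> outcome R G.

Definition rbs_accurate (R : realType) (alpha : R) (G : ugraph) (t : G)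
    (epsr delta : R) (est : G -> R) : Prop :=
  forall v : G,
    (delta <= ppr alpha v t ->
       `|est v - ppr alpha v t| <= epsr * ppr alpha v t) /\
    (ppr alpha v t < delta -> est v <= ppr alpha v t + delta).

(* The time bound is for constant alpha and epsr, and for p_f at least inverse
   polynomial in n, so that the factor log(1/p_f) is hidden in O~. *)
Record rbs_spec (R : realType) (d : measure_display) (Omega : measurableType d)
    (P : probability Omega R) (rbs : rbs_routine R Omega) : Prop := {
  rbs_est_measurable : forall (G : ugraph) alpha (t : G) epsr delta pf (v : G),
    measurable_fun [set: Omega]
      (fun w => (rbs G alpha t epsr delta pf w).1 v);
  rbs_time_measurable : forall (G : ugraph) alpha (t : G) epsr delta pf,
    measurable_fun [set: Omega]
      (fun w => (rbs G alpha t epsr delta pf w).2%:R : R);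
  (* The estimates are returned as a list of the nonzero ones. *)
  rbs_output_size : forall (G : ugraph) alpha (t : G) epsr delta pf w,
    (nnz (rbs G alpha t epsr delta pf w).1
       <= (rbs G alpha t epsr delta pf w).2)%N;
  rbs_correct : forall (G : ugraph) alpha (t : G) epsr delta pf,
    0 < alpha < 1 -> 0 < epsr -> 0 < delta -> 0 < pf < 1 ->
    ((1 - pf)%:E <=
       P [set w | rbs_accurate alpha t epsr delta
                    (rbs G alpha t epsr delta pf w).1])%E;
  rbs_time : forall (alpha epsr : R) (c : nat), 0 < alpha < 1 -> 0 < epsr ->
    exists (K : R) (k : nat), forall (G : ugraph) (t : G) (delta pf : R),
      0 < delta -> 0 < pf < 1 -> (order_of G)%:R ^- c <= pf ->
      (\int[P]_w ((rbs G alpha t epsr delta pf w).2%:R)%:E <=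
         (soft_bound K k (order_of G)
            ((order_of G)%:R * pagerank alpha t / delta))%:E)%E
}.

(* The power method, for given G, alpha, s and eps_d. *)
Definition power_routine (R : realType) : Type :=
  forall G : ugraph, R -> G -> R -> outcome R G.

Definition power_time (R : realType) (alpha : R) (pm : power_routine R) : Prop :=
  exists (K : R) (k : nat), forall (G : ugraph) (s : G) (eps : R), 0 < eps ->
    (@pm G alpha s eps).2%:R <= soft_bound K k (order_of G) ((order_of G)%:R ^+ 2).

Definition theta_square (R : realType) (tau : nat -> nat) : Prop :=
  exists c1 c2 : R, [/\ 0 < c1, 0 < c2 & forall n : nat,
    c1 * n%:R ^+ 2 <= (tau n)%:R <= c2 * n%:R ^+ 2].

Section AlgorithmD.
Variables (R : realType) (alpha : R) (Omega : Type) (rbs : rbs_routine R Omega).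
Variables (pm : power_routine R) (tau : nat -> nat).
Variables (G : ugraph) (pick : push_rule G) (eps : R) (s : G).

Let n := order_of G.
Let bpush := @backward_push R alpha G pick.

Section PhaseI.
Variable w : Omega.

Definition phase1 : outcome R G :=
  @rbs G alpha s 2^-1 (4^-1 * eps * (deg s)%:R) (n%:R ^- 2) w.

(* pi'(s,v) *)
Definition ppr1 (v : G) : R := phase1.1 v * (deg v)%:R / (deg s)%:R.

Definition candidates : {set G} :=
  [set t | 2^-1 * eps < ppr1 t / (deg t)%:R]%SET.

Definition phase1_cost : nat :=
  (phase1.2 + nnz phase1.1)%N.

End PhaseI.

Definition nr_init : nat := natceil (n%:R / eps).
Definition nt : nat := natceil (18 * ln (2 * n%:R ^+ 2) : R).

Definition rmax_init (w : Omega) (t : G) : R :=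
  (deg t)%:R ^+ 2 * eps ^+ 2 * nr_init%:R / (6 * ppr1 w t).

Definition push_all_cost (C : {set G}) (theta : G -> R) : nat :=
  \sum_(t in C) push_cost (bpush t (theta t)).

Definition walk_budget (nr : nat) : R :=
  nt%:R * (2^-1 * nr%:R) * mean_walk_cost alpha s.

(* Returns the final n_r, r_max and the cost. A repetition aborts as soon as its
   cost, counted in unit steps (possibly inside a push), exceeds the budget,
   i.e. after floor(budget) + 1 steps. When C is nonempty it aborts at the
   latest when nr = 0, hence the fuel nr + 1 below suffices. *)
Fixpoint phase2_loop (fuel : nat) (C : {set G}) (nr : nat) (rmax : G -> R)
    (cost : nat) : nat * (G -> R) * nat :=
  if fuel is fuel'.+1 then
    let full := push_all_cost C (fun t => 2^-1 * rmax t) in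
    if walk_budget nr < full%:R then
      (nr, rmax, cost + (Num.truncn (walk_budget nr)).+1)%N
    else
      phase2_loop fuel' C nr./2 (fun t => 2^-1 * rmax t)
        (cost + full + #|C|.+1)%N
  else (nr, rmax, cost).

(* If there is no candidate, all estimates are 0 and nothing is left to do (the
   loop, taken literally, would not end). *)
Definition phase2 (w : Omega) : nat * (G -> R) * nat :=
  if candidates w == finset.set0 then (0%N, rmax_init w, 0%N)
  else phase2_loop nr_init.+1 (candidates w) nr_init (rmax_init w) 0.

Definition nr_final (w : Omega) : nat := (phase2 w).1.1.
Definition rmax_final (w : Omega) : G -> R := (phase2 w).1.2.
Definition push_final (w : Omega) (t : G) : push_result R G :=
  bpush t (rmax_final w t).

Definition phase2_cost (w : Omega) : nat :=
  ((phase2 w).2 + push_all_cost (candidates w) (rmax_final w))%N.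

(* Walk number j of the i-th Monte Carlo estimation is ws (i, j). *)
Definition batch (w : Omega) : choiceType :=
  {ffun 'I_nt * 'I_(nr_final w) -> seq G}.

Section PhaseIII.
Variables (w : Omega) (ws : batch w).

(* pi''_i(s,v) *)
Definition ppr2 (i : 'I_nt) (v : G) : R :=
  #|[set j | last s (ws (i, j)) == v]%SET|%:R / (nr_final w)%:R.

Definition trial (i : 'I_nt) (t : G) : R :=
  reserve (push_final w t) s +
  \sum_(v : G | residue (push_final w t) v != 0)
     ppr2 i v * residue (push_final w t) v.

Definition estimate (t : G) : R :=
  if t \in candidates w then
    nth 0 (sort <=%R [seq trial i t | i <- enum 'I_nt]) (uphalf nt).-1
  else 0.

(* Walks, then the sums defining the trials, then linear-time selection. *)
Definition phase3_cost : nat :=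
  (\sum_(x : 'I_nt * 'I_(nr_final w)) walk_cost (ws x) +
   nt * \sum_(t in candidates w)
          (nnz (residue (push_final w t))).+1 +
   #|candidates w| * nt)%N.

Definition unguarded : outcome R G :=
  (estimate, (phase1_cost w + phase2_cost w + phase3_cost)%N).

(* The safeguard fires when the cost reaches tau n. *)
Definition algorithmD : outcome R G :=
  if (unguarded.2 < tau n)%N then unguarded
  else ((@pm G alpha s eps).1, (tau n + (@pm G alpha s eps).2)%N).

End PhaseIII.
End AlgorithmD.

(* Expectation over the seed of RBS and, independently, over the walks. *)
Definition expected_time (R : realType) (alpha : R) (d : measure_display)
    (Omega : measurableType d) (P : probability Omega R)
    (rbs : rbs_routine R Omega) (pm : power_routine R) (tau : nat -> nat)
    (G : ugraph) (pick : push_rule G) (eps : R) (s : G) : \bar R :=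
  (\int[P]_w \esum_(ws in [set: batch alpha rbs pick eps s w])
     (batch_prob alpha s ws *
      (algorithmD pm tau ws).2%:R)%:E)%E.

Definition source_prob (R : realType) (G : ugraph) (s : G) : R :=
  (deg s)%:R / (2 * (size_of G)%:R).

Section Termination.
Variables (R : realType) (alpha : R) (G : ugraph) (pick : push_rule G).
Hypotheses (alpha01 : 0 < alpha < 1) (pick_ok : push_rule_ok pick).

Lemma deg_gt0 (v : G) : (0 < deg v)%N.
Proof.
have [u uv] := adj_no_isolated v.
by apply/card_gt0P; exists u; rewrite inE.
Qed.

Let pot (r : G -> R) := \sum_(u : G) (deg u)%:R * r u.

Lemma pot_push (v : G) (x : push_result R G) :
  pot (residue (push alpha v x)) =
  pot (residue x) - alpha * (deg v)%:R * residue x v.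
Proof.
set r := residue x; rewrite /pot /= -/r.
rewrite (bigD1 v) //= eqxx mulr0 add0r [X in _ = X - _](bigD1 v) //=.
have -> : \sum_(i | i != v) (deg i)%:R *
    (if i == v then 0
     else if adj v i then r i + (1 - alpha) * r v / (deg i)%:R else r i) =
  \sum_(i | i != v) (deg i)%:R * r i +
  \sum_(i | i != v) (if adj v i then (1 - alpha) * r v else 0).
  rewrite -big_split /=; apply: eq_bigr => i /negPf ->.
  case: ifP => _; last by rewrite addr0.
  rewrite mulrDr; congr (_ + _).
  by rewrite mulrC divfK // pnatr_eq0 -lt0n deg_gt0.
have -> : \sum_(i | i != v) (if adj v i then (1 - alpha) * r v else 0) =
    (deg v)%:R * ((1 - alpha) * r v).
  rewrite -big_mkcondr /= (eq_bigl (fun i => i \in [set u | adj v u]%SET)).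
    by rewrite sumr_const mulr_natl.
  move=> i; rewrite inE; case: eqP => [->|//]; by rewrite adj_irr.
rewrite mulrBl mul1r mulrBr [alpha * _ * _]mulrAC [X in _ = _ - X]mulrC.
by rewrite addrA; congr (_ - _); rewrite addrC.
Qed.

Lemma push_ge0 (v : G) (x : push_result R G) :
  (forall u, 0 <= residue x u) -> forall u, 0 <= residue (push alpha v x) u.
Proof.
move=> x0 u /=; case: ifP => // _; case: ifP => // _.
have /andP[_ /ltW a1] := alpha01.
by rewrite addr_ge0 // divr_ge0 // mulr_ge0 // subr_ge0.
Qed.

Lemma push_loop_halts fuel t theta h x : 0 < theta ->
  (forall u, 0 <= residue x u) ->
  pot (residue x) < fuel%:R * (alpha * theta) ->
  active theta (residue (push_loop alpha pick fuel t theta h x)) = finset.set0.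
Proof.
move=> th0; have /andP[a0 _] := alpha01.
elim: fuel h x => [|f IH] h x x0 hpot /=.
  suff : 0 <= pot (residue x) by rewrite leNgt; move: hpot; rewrite mul0r => ->.
  by apply: sumr_ge0 => u _; rewrite mulr_ge0.
case: eqP => // /eqP A0; apply: IH; first exact: push_ge0.
rewrite pot_push ltrBlDr (lt_le_trans hpot) //.
rewrite -natr1 mulrDl mul1r lerD2l -mulrA ler_pM2l //.
have := pick_ok t h A0; rewrite inE => /ltW /le_trans; apply.
by rewrite ler_peMl // ler1n deg_gt0.
Qed.

Lemma push_fuel_enough (t : G) (theta : R) : 0 < theta ->
  active theta (residue (backward_push alpha pick t theta)) = finset.set0.
Proof.
move=> th0; have /andP[a0 _] := alpha01.
apply: push_loop_halts => //=.
rewrite /pot (bigD1 t) //= eqxx mulr1 big1 => [|u /negPf ->]; last by rewrite mulr0.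
rewrite addr0 -ltr_pdivrMr ?mulr_gt0 //; exact: truncnS_gt.
Qed.

End Termination.

Lemma push_loop_cost_ge (R : realType) (alpha : R) (G : ugraph)
    (pick : push_rule G) fuel t theta h (x : push_result R G) :
  (push_cost x <= push_cost (push_loop alpha pick fuel t theta h x))%N.
Proof.
elim: fuel h x => [|f IH] h x /=; case: ifP => // _.
by apply: leq_trans (IH _ _); rewrite /= leq_addr.
Qed.

(* The loop of phase II is left by an abort, not for lack of fuel. *)
Lemma phase2_loop_exits (R : realType) (alpha : R) (G : ugraph)
    (pick : push_rule G) (s : G) fuel (C : {set G}) nr (rmax : G -> R) cost :
  C != finset.set0 -> (nr < fuel)%N ->
  let x := phase2_loop alpha pick s fuel C nr rmax cost in
  walk_budget alpha s x.1.1 <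
    (push_all_cost alpha pick C (fun t => 2^-1 * x.1.2 t))%:R.
Proof.
move=> C0; elim: fuel nr rmax cost => [//|f IH] nr rmax cost /=; rewrite ltnS => nrf.
case: ifP => [//|]; case: nr nrf => [|nr] nrf.
  rewrite /walk_budget !mulr0 mul0r ltr0n => /negP[].
  have [t tC] := set0Pn _ C0.
  rewrite /push_all_cost (bigD1 t) //= ltn_addr //.
  exact: leq_trans (push_loop_cost_ge _ _ _ _ _ _ _).
move=> _; apply: IH; apply: leq_trans nrf.
by rewrite -[X in (_ < X)%N]/(nr.+1) ltnS /= leq_uphalf_double -addnn leq_addr.
Qed.

(* Main.v *)
(* The mass I(s) = \sum_t ppr s t / deg t equals \sum_t ppr t s / deg s, because
   walks are reversible with respect to deg; hence its average over s is n / 2m.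
   When RBS is accurate the candidates carry mass at most 3/2 I(s).  Pushing at
   thresholds proportional to n_r costs at most #|C| + F with F * b <= D, where b
   is the walk budget for n_r and D = O~(I(s) / eps^2): halving n_r doubles F and
   halves b.  So both the work of a completed repetition and the budget at the
   abort are at most #|C| + (D / z + z) / 2 for every z > 0; with
   z = sqrt (n / m) / eps this averages to O~(sqrt (n / m) / eps).  There are
   O(log n) repetitions unless eps < n^-3; in that case, and when RBS fails
   (probability n^-2), the safeguard bounds the cost by O~(n^2). *)
Require Import Defs.
From HB Require Import structures.
From mathcomp Require Import all_boot all_order all_algebra.
From mathcomp Require Import all_classical all_reals all_analysis.
From mathcomp Require Import measurable_realfun.
From mathcomp Require Import ring lra zify.
Import Order.TTheory GRing.Theory Num.Theory.

Set Implicit Arguments.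
Unset Strict Implicit.
Unset Printing Implicit Defensive.

Local Open Scope classical_set_scope.
Local Open Scope ring_scope.

(** * Degrees, nodes and edges counted against each other *)

Section GraphCounting.
Variable G : ugraph.

Lemma sum_deg_card : (\sum_(v : G) deg v = #|[set e : G * G | adj e.1 e.2]%SET|)%N.
Proof.
rewrite -sum1dep_card -(pair_big_dep xpredT (fun u v => @adj G u v) (fun _ _ => 1%N)).
by apply: eq_bigr => v _; rewrite sum1dep_card.
Qed.

(** The map from adjacent ordered pairs to edges has fibres of at most two elements, [(a, b)] and
    [(b, a)]. *)
Lemma sum_deg_le : (\sum_(v : G) deg v <= 2 * size_of G)%N.
Proof.
rewrite sum_deg_card -sum1_card.
rewrite (partition_big (fun e : G * G => [set e.1; e.2]%SET) (mem (edges G))) /=; last first.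
  by move=> e; rewrite inE => ue; apply/imsetP; exists e; rewrite ?inE.
rewrite /size_of mulnC -sum_nat_const; apply: leq_sum => E.
case/imsetP => -[a b] _ ->; rewrite sum1_card.
rewrite (leq_trans (subset_leq_card (_ : _ \subset [set (a, b); (b, a)]%SET))) //; last first.
  by rewrite cards2; case: eqP.
apply/fintype.subsetP => -[x y]; rewrite !inE /= => /andP[xy /eqP Exy].
have nxy : x != y by apply: contraTneq xy => ->; rewrite inE /= adj_irr.
have : x \in [set a; b]%SET by rewrite -Exy !inE eqxx.
have : y \in [set a; b]%SET by rewrite -Exy !inE eqxx orbT.
rewrite !inE !xpair_eqE.
case/orP => /eqP ye; case/orP => /eqP xe; move: nxy; rewrite ye xe ?eqxx //=.
by rewrite orbT.
Qed.

Lemma order_le_sum_deg : (order_of G <= \sum_(v : G) deg v)%N.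
Proof. by rewrite /order_of -sum1_card leq_sum // => v _; apply: deg_gt0. Qed.

Lemma order_le_size : (order_of G <= 2 * size_of G)%N.
Proof. exact: leq_trans order_le_sum_deg sum_deg_le. Qed.

Lemma size_le_square : (size_of G <= order_of G ^ 2)%N.
Proof.
rewrite (leq_trans (leq_imset_card _ _)) //.
by rewrite (leq_trans (max_card _)) // card_prod expnS expn1.
Qed.

(** A neighbor differs from the node, there being no loops. This keeps [ln n] away from 0 as soon as
    a source exists. *)
Lemma order_gt1 : G -> (1 < order_of G)%N.
Proof.
move=> v; have [u uv] := adj_no_isolated v.
rewrite (leq_trans (_ : _ <= #|[set u; v]%SET|)%N) ?max_card // cards2.
by case: eqP uv => // ->; rewrite adj_irr.
Qed.

End GraphCounting.

Lemma source_prob_ge0 (R : realType) (G : ugraph) (s : G) : 0 <= source_prob R s.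
Proof. by rewrite divr_ge0 // mulr_ge0. Qed.

Lemma sum_source_prob (R : realType) (G : ugraph) : \sum_(s : G) source_prob R s <= 1.
Proof.
rewrite -mulr_suml -natr_sum -natrM.
have [->|m0] := eqVneq (2 * size_of G)%N 0%N; first by rewrite invr0 mulr0.
by rewrite ler_pdivrMr ?ltr0n ?lt0n // mul1r ler_nat sum_deg_le.
Qed.

(** * Length of walks, personalized PageRank and its reversibility *)

Section WalkMass.
Variables (R : realType) (alpha : R) (G : ugraph).
Hypothesis alpha01 : 0 < alpha < 1.
Let a0 : 0 < alpha. Proof. by case/andP: alpha01. Qed.
Let a1 : alpha < 1. Proof. by case/andP: alpha01. Qed.
Implicit Types (u v s t : G) (p : seq G).

Lemma walk_prob_ge0 u p : 0 <= walk_prob alpha u p.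
Proof.
elim: p u => [|v p IH] u /=; first exact: ltW.
by rewrite !mulr_ge0 // ?subr_ge0 ?(ltW a1) // invr_ge0.
Qed.

Lemma sum_adj_deg u : \sum_v (adj u v)%:R / (deg u)%:R = 1 :> R.
Proof.
rewrite -mulr_suml -natr_sum (_ : (\sum_v adj u v)%N = deg u).
  by rewrite divff // pnatr_eq0 -lt0n deg_gt0.
by rewrite /deg -sum1dep_card [RHS]big_mkcond; apply: eq_bigr => v _; case: adj.
Qed.

(** The walk length is geometric whatever the start: the first step has total weight [1 - alpha],
    and the sum over the tails does not depend on the node reached. *)
Lemma sum_walk_prob_tuple u k :
  \sum_(p : k.-tuple G) walk_prob alpha u p = alpha * (1 - alpha) ^+ k.
Proof.
elim: k u => [|k IH] u.
  rewrite (bigD1 [tuple]) //= big1 ?addr0 ?expr0 ?mulr1 // => p.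
  by rewrite [p]tuple0 => /eqP.
pose h (x : G * k.-tuple G) : k.+1.-tuple G := [tuple of x.1 :: x.2].
rewrite (reindex h) /=; last first.
  exists (fun p : k.+1.-tuple G => (thead p, [tuple of behead p])) => [[v p] _|p _] /=.
    by congr (_, _); apply: val_inj.
  by apply: val_inj; rewrite /= [in RHS](tuple_eta p).
rewrite -(pair_bigA _ (fun v (p : k.-tuple G) => walk_prob alpha u (v :: p))) /=.
under eq_bigr => v _ do rewrite -mulr_sumr IH mulrAC.
by rewrite -mulr_sumr sum_adj_deg mulr1 exprS mulrCA mulrA.
Qed.

Lemma esum_finType (T : finType) (f : T -> \bar R) :
  (forall x, 0 <= f x)%E -> (\esum_(x in [set: T]) f x = \sum_x f x)%E.
Proof.
move=> f0; rewrite esum_fset //; last exact: finite_finset.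
rewrite fsbig_finite /=; last exact: finite_finset.
apply: perm_big; apply: uniq_perm; [exact: finmap.fset_uniq|exact: index_enum_uniq|].
move=> x; rewrite mem_index_enum; apply: etrans (in_fset_set _ x) _; first exact: finite_finset.
exact: mem_set.
Qed.

(** Grouping the walks by length turns a sum over walks into a power series in [1 - alpha]. *)
Lemma esum_walk_size u (g : nat -> R) : (forall k, 0 <= g k) ->
  (\esum_(p in [set: seq G]) (walk_prob alpha u p * g (size p))%:E =
   \sum_(0 <= k <oo) (alpha * (1 - alpha) ^+ k * g k)%:E)%E.
Proof.
move=> g0.
have f0 p : (0 <= (walk_prob alpha u p * g (size p))%:E)%E.
  by rewrite lee_fin mulr_ge0 // walk_prob_ge0.
have -> : [set: seq G] = \bigcup_k [set p | size p = k].
  by apply/seteqP; split => p // _; exists (size p).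
rewrite nneseries_sum_bigcup //; last first.
  by move=> i j _ _ [p [/= <- <-]].
apply: eq_eseriesr => k _.
rewrite (@reindex_esum _ _ _ [set: k.-tuple G] _ (@tval k G)); last first.
  split=> [p _ /=|p q _ _|p /= pk]; [exact: size_tuple|exact: val_inj|].
  by exists (Tuple (introT eqP pk)).
rewrite esum_finType // sumEFin -[in RHS](sum_walk_prob_tuple u) mulr_suml.
by congr EFin; apply: eq_bigr => p _; rewrite size_tuple.
Qed.

Lemma esum_walk_prob u : (\esum_(p in [set: seq G]) (walk_prob alpha u p)%:E = 1)%E.
Proof.
transitivity (\sum_(0 <= k <oo) (alpha * (1 - alpha) ^+ k * 1)%:E)%E.
  by rewrite -(esum_walk_size u) //; apply: eq_esum => p _; rewrite mulr1.
apply/cvg_lim => //; apply: cvg_EFin; first by apply: nearW => k; rewrite sumEFin.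
rewrite [X in X @ _ --> _](_ : _ = series (geometric alpha (1 - alpha))); last first.
  by apply/funext => k /=; rewrite sumEFin /=; apply: eq_bigr => i _; rewrite mulr1.
have /(@cvg_geometric_series _ alpha) : `|1 - alpha| < 1.
  by rewrite ger0_norm ?subr_ge0 ?(ltW a1) // ltrBlDr ltrDl.
by rewrite subKr divff ?gt_eqF.
Qed.

Let geometric_mean_le N :
  \sum_(0 <= k < N) alpha * (1 - alpha) ^+ k * k.+1%:R <= alpha^-1.
Proof.
(* Closed form of the partial sum, by induction on [N]; the term subtracted from 1 is
   nonnegative. *)
suff E : alpha * \sum_(0 <= k < N) alpha * (1 - alpha) ^+ k * k.+1%:R =
    1 - (1 - alpha) ^+ N * (1 + N%:R * alpha).
  rewrite -(ler_pM2l a0) E divff ?gt_eqF // lerBlDr lerDl.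
  by rewrite mulr_ge0 ?exprn_ge0 ?subr_ge0 ?(ltW a1) // addr_ge0 // mulr_ge0 // ltW.
elim: N => [|N IH]; first by rewrite big_geq //; ring.
by rewrite big_nat_recr //= mulrDr IH exprS -natr1; ring.
Qed.

Lemma esum_walk_cost_le u :
  (\esum_(p in [set: seq G]) (walk_prob alpha u p * (walk_cost p)%:R)%:E
   <= (alpha^-1)%:E)%E.
Proof.
rewrite (esum_walk_size u (g := fun k => k.+1%:R)) //.
apply: lime_le; last by apply: nearW => N; rewrite sumEFin lee_fin geometric_mean_le.
by apply: is_cvg_nneseries => k _ _; rewrite lee_fin !mulr_ge0 // ?exprn_ge0 ?subr_ge0 ?ltW.
Qed.

(** [mean_walk_cost] is defined through [fine], which is faithful here because the sum is at most
    [1 / alpha]. *)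
Lemma esum_walk_cost u :
  (\esum_(p in [set: seq G]) (walk_prob alpha u p * (walk_cost p)%:R)%:E
   = (mean_walk_cost alpha u)%:E)%E.
Proof.
rewrite /mean_walk_cost fineK // ge0_fin_numE; last first.
  by apply: esum_ge0 => p _; rewrite lee_fin mulr_ge0 ?walk_prob_ge0.
exact: le_lt_trans (esum_walk_cost_le u) (ltry _).
Qed.

Lemma mean_walk_cost_le u : mean_walk_cost alpha u <= alpha^-1.
Proof. by rewrite -lee_fin -esum_walk_cost esum_walk_cost_le. Qed.

Lemma mean_walk_cost_ge0 u : 0 <= mean_walk_cost alpha u.
Proof.
by rewrite -lee_fin -esum_walk_cost esum_ge0 // => p _; rewrite lee_fin mulr_ge0 ?walk_prob_ge0.
Qed.

Lemma esum_ppr u v :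
  (\esum_(p in [set p | last u p = v]) (walk_prob alpha u p)%:E
   = (ppr alpha u v)%:E)%E.
Proof.
have w0 p : (0 <= (walk_prob alpha u p)%:E)%E by rewrite lee_fin walk_prob_ge0.
rewrite /ppr fineK // ge0_fin_numE; last exact: esum_ge0.
apply: le_lt_trans (ltry 1); rewrite -(esum_walk_prob u) esum_mkcond.
by apply: le_esum => p _; case: ifP.
Qed.

Lemma ppr_ge0 u v : 0 <= ppr alpha u v.
Proof. by rewrite -lee_fin -esum_ppr esum_ge0 // => p _; rewrite lee_fin walk_prob_ge0. Qed.

(** Every walk ends at exactly one node, so exchanging the sums leaves the total mass of the
    walks. *)
Lemma sum_ppr u : \sum_v ppr alpha u v = 1.
Proof.
apply: EFin_inj; rewrite -sumEFin.
under eq_bigr => v _ do rewrite -esum_ppr esum_mkcond.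
rewrite -esum_sum; last by move=> p v _ _; case: ifP => // _; rewrite lee_fin walk_prob_ge0.
rewrite -[RHS](esum_walk_prob u); apply: eq_esum => p _.
rewrite (bigD1 (last u p)) //= mem_set // big1 ?adde0 // => v vp.
by rewrite memNset //= => pv; rewrite pv eqxx in vp.
Qed.

(** The code of a walk omits its start, so the walk run backwards from [last u p] omits that node
    and ends with [u]. *)
Let walk_rev u p := rev (belast u p).

Lemma walk_prob_rcons u p v :
  walk_prob alpha u (rcons p v) =
  walk_prob alpha u p * ((1 - alpha) * ((adj (last u p) v)%:R / (deg (last u p))%:R)).
Proof. by elim: p u => [|w p IH] u /=; [rewrite mulrC | rewrite IH mulrA]. Qed.

(** A walk has a factor [1 / deg] for each node but its last one. Multiplying by the degree of the
    start leaves these factors at the inner nodes only, which is symmetric under reversal. *)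
Lemma walk_prob_rev u p :
  (deg u)%:R * walk_prob alpha u p =
  (deg (last u p))%:R * walk_prob alpha (last u p) (walk_rev u p).
Proof.
have d0 v : (deg v)%:R != 0 :> R by rewrite pnatr_eq0 -lt0n deg_gt0.
elim: p u => [//|v p IH] u; rewrite /walk_rev /= rev_cons walk_prob_rcons -/(walk_rev v p).
have -> : last (last v p) (walk_rev v p) = v.
  by rewrite /walk_rev; case: p {IH} => [//|w p] /=; rewrite rev_cons last_rcons.
rewrite mulrA -IH [adj v u]adj_sym.
transitivity ((1 - alpha) * (adj u v)%:R * walk_prob alpha v p * ((deg u)%:R / (deg u)%:R)).
  by ring.
transitivity ((1 - alpha) * (adj u v)%:R * walk_prob alpha v p * ((deg v)%:R / (deg v)%:R)).
  by rewrite !divff.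
by ring.
Qed.

(** Reversal is a bijection between the walks from [u] to [v] and those from [v] to [u]. *)
Lemma ppr_reversible u v :
  (deg u)%:R * ppr alpha u v = (deg v)%:R * ppr alpha v u.
Proof.
apply: EFin_inj; rewrite !EFinM -!esum_ppr.
have revK x p : walk_rev (last x p) (walk_rev x p) = p.
  rewrite /walk_rev -[RHS](revK p); congr rev.
  by apply: (@rcons_injl _ (last (last x p) (rev (belast x p)))); rewrite -lastI -rev_rcons -lastI;
     case: (p) => //= y q; rewrite !rev_cons last_rcons.
have lastK x p : last (last x p) (walk_rev x p) = x.
  by rewrite /walk_rev; case: p => [//|w p] /=; rewrite rev_cons last_rcons.
rewrite [in RHS](@reindex_esum _ _ _ [set p | last u p = v] _ (walk_rev u)); last first.
  split=> [p /= <-|p q|p /= pu]; first exact: lastK.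
    by rewrite !inE /= => pv qv E; rewrite -(revK u p) -(revK u q) pv qv E.
  by exists (walk_rev v p); rewrite -pu ?revK //= lastK.
(* The scalar is a degree, so it can enter the sum by repeated addition. *)
have esumZ (S : set (seq G)) (c : nat) (f : seq G -> R) : (forall p, 0 <= f p) ->
    (c%:R%:E * (\esum_(p in S) (f p)%:E) = \esum_(p in S) (c%:R * f p)%:E)%E.
  move=> f0; elim: c => [|c IH]; first by rewrite mul0e esum1 // => p _; rewrite mul0r.
  rewrite -natr1 EFinD ge0_muleDl ?lee_fin // IH mul1e -esumD; last 2 first.
  - by move=> p _; rewrite lee_fin mulr_ge0.
  - by move=> p _; rewrite lee_fin.
  by apply: eq_esum => p _; rewrite mulrDl mul1r.
rewrite !esumZ; [|by move=> p; apply: walk_prob_ge0|by move=> p; apply: walk_prob_ge0].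
by apply: eq_esum => p /= <-; rewrite walk_prob_rev.
Qed.
End WalkMass.

(** * Expected cost of a family of independent walks *)

Section BatchExpectation.
Variables (R : realType) (alpha : R) (G : ugraph) (s : G) (I : finType).
Hypothesis alpha01 : 0 < alpha < 1.

Lemma batch_prob_ge0 (ws : {ffun I -> seq G}) : 0 <= batch_prob alpha s ws.
Proof. by apply: prodr_ge0 => i _; apply: walk_prob_ge0. Qed.

(** Walks of at most [N] steps form a finite type, on which a product of sums can be expanded. *)
Let bounded_mass_le (N : nat) (g : seq G -> R) (M : R) :
    (forall p, 0 <= g p) ->
    (\esum_(p in [set: seq G]) (walk_prob alpha s p * g p)%:E <= M%:E)%E ->
  \sum_(b : N.-bseq G) walk_prob alpha s b * g b <= M.
Proof.
move=> g0 leM; rewrite -lee_fin -sumEFin; apply: le_trans leM.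
have f0 p : (0 <= (walk_prob alpha s p * g p)%:E)%E.
  by rewrite lee_fin mulr_ge0 // walk_prob_ge0.
rewrite -(@esum_finType R _ (fun b : N.-bseq G => (walk_prob alpha s b * g b)%:E)) //.
rewrite -(@esum_image R _ _ setT (fun b : N.-bseq G => val b) (fun p => (walk_prob alpha s p * g p)%:E)).
  by rewrite esum_mkcond; apply: le_esum => p _; case: ifP.
by move=> b c _ _; exact: val_inj.
Qed.

Let bounded_batch_le (N : nat) (c e : R) : 0 <= c -> 0 <= e ->
  \sum_(h : {ffun I -> N.-bseq G}) (\prod_i walk_prob alpha s (h i)) *
     (c + e * \sum_x (walk_cost (h x))%:R)
  <= c + e * (#|I|%:R * mean_walk_cost alpha s).
Proof.
move=> c0 e0.
have mass1 : \sum_(b : N.-bseq G) walk_prob alpha s b <= 1.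
  rewrite (eq_bigr (fun b : N.-bseq G => walk_prob alpha s b * (fun=> 1) (val b))).
    apply: (@bounded_mass_le N (fun=> 1)) => //.
    by rewrite -(esum_walk_prob alpha01 s); apply: le_esum => p _; rewrite mulr1.
  by move=> b _; rewrite mulr1.
have mass0 : 0 <= \sum_(b : N.-bseq G) walk_prob alpha s b.
  by apply: sumr_ge0 => b _; apply: walk_prob_ge0.
under eq_bigr do rewrite mulrDr mulrCA mulr_sumr.
rewrite big_split /= -mulr_sumr exchange_big /=; apply: lerD.
  rewrite -mulr_suml ler_piMl //.
  rewrite -(bigA_distr_bigA (fun (i : I) (b : N.-bseq G) => walk_prob alpha s b)).
  by apply: prodr_ile1 => i _; rewrite mass0.
apply: ler_wpM2l => //; rewrite mulr_natl -sumr_const; apply: ler_sum => x _.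
(* The cost of walk [x] is absorbed into the factor of index [x], so the sum over families is a
   product again; its other factors are at most 1. *)
pose F i (b : N.-bseq G) := walk_prob alpha s b * (if i == x then (walk_cost b)%:R else 1).
rewrite (eq_bigr (fun h : {ffun I -> N.-bseq G} => \prod_i F i (h i))); last first.
  move=> h _; rewrite big_split /=; congr (_ * _).
  by rewrite -big_mkcond /= big_pred1_eq.
rewrite -(bigA_distr_bigA F) (bigD1 x) //= -[leRHS]mulr1.
have F0 i b : 0 <= F i b by rewrite mulr_ge0 ?walk_prob_ge0 //; case: ifP.
apply: ler_pM.
- by apply: sumr_ge0 => b _.
- by apply: prodr_ge0 => i _; apply: sumr_ge0.
- rewrite /F eqxx; apply: (@bounded_mass_le N (fun p => (walk_cost p)%:R)) => //.
  by rewrite esum_walk_cost.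
apply: prodr_ile1 => i ix; rewrite sumr_ge0 //= /F (negPf ix).
by under eq_bigr do rewrite mulr1.
Qed.

(** The infinite sum is a supremum over finite sets [X] of families, and the walks occurring in such
    an [X] have bounded length. *)
Lemma esum_batch_le (c e : R) : 0 <= c -> 0 <= e ->
  (\esum_(ws in [set: {ffun I -> seq G}])
     (batch_prob alpha s ws * (c + e * \sum_x (walk_cost (ws x))%:R))%:E
   <= (c + e * (#|I|%:R * mean_walk_cost alpha s))%:E)%E.
Proof.
move=> c0 e0; set f := fun ws : {ffun I -> seq G} => _.
have f0 ws : (0 <= f ws)%E.
  by rewrite lee_fin mulr_ge0 ?batch_prob_ge0 // addr_ge0 // mulr_ge0 // sumr_ge0.
apply: ge_ereal_sup => _ [X [finX _] <-].
pose N := (\max_(ws <- finmap.enum_fset (fset_set X)) \max_i size (ws i))%N.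
pose phi (h : {ffun I -> N.-bseq G}) : {ffun I -> seq G} := [ffun i => val (h i)].
apply: (@le_trans _ _ (\esum_(ws in range phi) f ws)%E); last first.
  rewrite esum_image; last first.
    move=> h k _ _ /ffunP E; apply/ffunP => i; apply: val_inj.
    by have := E i; rewrite !ffunE.
  rewrite esum_finType // sumEFin lee_fin.
  apply: le_trans (bounded_batch_le N c0 e0); apply: ler_sum => h _.
  rewrite /batch_prob le_eqVlt; apply/orP; left; apply/eqP; congr (_ * (_ + _ * _)).
    by apply: eq_bigr => i _; rewrite ffunE.
  by apply: eq_bigr => i _; rewrite ffunE.
rewrite -esum_fset //; rewrite esum_mkcond [leRHS]esum_mkcond.
apply: le_esum => ws _; case: ifP => [wsX|_]; last by case: ifP.
rewrite mem_set //.
have sz i : (size (ws i) <= N)%N.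
  apply: (@leq_trans (\max_i size (ws i))); first exact: (leq_bigmax i).
  by apply: leq_bigmax_seq => //; rewrite in_fset_set.
by exists [ffun i => Bseq (sz i)] => //; apply/ffunP => i; rewrite !ffunE.
Qed.

End BatchExpectation.

(** * Cost of Backward Push *)

Section PushCost.
Variables (R : realType) (alpha : R) (G : ugraph) (pick : push_rule G).
Hypotheses (alpha01 : 0 < alpha < 1) (pick_ok : push_rule_ok pick).
Let a0 : 0 < alpha. Proof. by case/andP: alpha01. Qed.

(* The potential \sum_u deg u * residue u pays for the pushes: a push at v costs
   (deg v).+1 <= 2 * deg v and lowers it by at least alpha * theta * deg v. *)
Lemma push_loop_cost_le fuel t theta h (x : push_result R G) :
  0 < theta -> (forall u, 0 <= residue x u) ->
  (push_cost (push_loop alpha pick fuel t theta h x))%:R * (alpha * theta) <=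
  (push_cost x)%:R * (alpha * theta) + 2 * \sum_u (deg u)%:R * residue x u.
Proof.
move=> th0; elim: fuel h x => [|f IH] h x x0 /=; case: eqP => [_|/eqP A0];
  try by rewrite lerDl mulr_ge0 // sumr_ge0 // => u _; rewrite mulr_ge0.
set v := pick t _ h; apply: (le_trans (IH _ _ (push_ge0 alpha01 v x0))).
have /= -> := pot_push alpha v x.
have vth : theta <= residue x v by have := pick_ok t h A0; rewrite inE => /ltW.
have d1 : (deg v).+1%:R <= 2 * (deg v)%:R :> R.
  by rewrite -natrM ler_nat mul2n -addnn -addn1 leq_add2l deg_gt0.
rewrite natrD mulrDl -addrA lerD2l mulrBr addrCA gerDl subr_le0.
rewrite (le_trans (ler_wpM2r _ d1)) ?mulr_ge0 ?(ltW a0) ?(ltW th0) //.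
by rewrite -!mulrA ler_pM2l // mulrCA ler_pM2l // ler_wpM2l.
Qed.

(** At the start the potential is [deg t] and the cost is 1. *)
Lemma backward_push_cost_le t theta : 0 < theta ->
  (push_cost (backward_push alpha pick t theta))%:R <=
  1 + 2 * (deg t)%:R / (alpha * theta).
Proof.
move=> th0; have at0 : 0 < alpha * theta by rewrite mulr_gt0.
rewrite -(ler_pM2r at0) mulrDl divfK ?gt_eqF //.
apply: le_trans (push_loop_cost_le _ _ _ th0 _) _ => //=.
by rewrite (bigD1 t) //= eqxx mulr1 big1 ?addr0 // => u /negPf ->; rewrite mulr0.
Qed.

Lemma nnz_residue_push v (x : push_result R G) :
  (nnz (residue (push alpha v x)) <= nnz (residue x) + deg v)%N.
Proof.
rewrite /nnz (leq_trans _ (leq_card_setU _ _)) //; apply: subset_leq_card.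
apply/fintype.subsetP => u; rewrite !inE /=; case: ifP => _; first by rewrite eqxx.
by case: ifP => _ xu; rewrite ?orbT ?orbF.
Qed.

Lemma nnz_push_loop fuel t theta h (x : push_result R G) :
  (nnz (residue x) <= push_cost x)%N ->
  (nnz (residue (push_loop alpha pick fuel t theta h x)) <=
   push_cost (push_loop alpha pick fuel t theta h x))%N.
Proof.
elim: fuel h x => [|f IH] h x /= le_x; case: ifP => // _.
apply: IH; rewrite (leq_trans (nnz_residue_push _ _)) //= leq_add //.
Qed.

(** The sums of phase III range over the support of the residue; this charges them to the pushes,
    since a push at [v] creates at most [deg v] new nonzero entries. *)
Lemma nnz_backward_push t theta :
  (nnz (residue (backward_push alpha pick t theta)) <=
   push_cost (backward_push alpha pick t theta))%N.
Proof.
apply: nnz_push_loop; rewrite /nnz /= (leq_trans (subset_leq_card (_ : _ \subset [set t]%SET))) ?cards1 //.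
by apply/fintype.subsetP => u; rewrite !inE; case: (u == t); rewrite ?eqxx.
Qed.

Lemma backward_push_cost_gt0 t theta :
  (0 < push_cost (backward_push alpha pick t theta))%N.
Proof. exact: leq_trans (push_loop_cost_ge _ _ _ _ _ _ _). Qed.

End PushCost.

(** * The balancing loop of phase II *)

Section Phase2.
Variables (R : realType) (alpha : R) (G : ugraph) (pick : push_rule G) (s : G).
Hypotheses (alpha01 : 0 < alpha < 1) (pick_ok : push_rule_ok pick).
Let a0 : 0 < alpha. Proof. by case/andP: alpha01. Qed.
Variable C : {set G}.

Let full rmax := push_all_cost alpha pick C (fun t => 2^-1 * rmax t).

(* Bounds the cost of pushing at thresholds rmax / 2, apart from the unit of
   initialisation per target. *)
Definition push_charge (rmax : G -> R) : R :=
  \sum_(t in C) 4 * (deg t)%:R / (alpha * rmax t).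

Lemma push_charge_half rmax :
  push_charge (fun t => 2^-1 * rmax t) = 2 * push_charge rmax.
Proof.
rewrite /push_charge mulr_sumr; apply: eq_bigr => t _.
by rewrite mulrCA invfM invrK [RHS]mulrCA !mulrA.
Qed.

Lemma push_charge_ge0 rmax : (forall t, t \in C -> 0 < rmax t) -> 0 <= push_charge rmax.
Proof.
move=> r0; apply: sumr_ge0 => t tC.
by rewrite divr_ge0 ?mulr_ge0 ?(ltW a0) // ltW // r0.
Qed.

Lemma push_all_cost_half_le rmax : (forall t, t \in C -> 0 < rmax t) ->
  (full rmax)%:R <= #|C|%:R + push_charge rmax.
Proof.
move=> r0; rewrite natr_sum -[in leRHS]sum1_card natr_sum -big_split /=.
apply: ler_sum => t tC; have rt := r0 t tC.
apply: le_trans (backward_push_cost_le alpha01 pick_ok _ _) _; first by rewrite mulr_gt0.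
rewrite lerD2l le_eqVlt; apply/orP; left; apply/eqP; field.
by rewrite !gt_eqF.
Qed.

(** [push_charge] is sized for thresholds [rmax / 2], so it is twice what thresholds [rmax]
    require. *)
Lemma push_all_cost_le rmax : (forall t, t \in C -> 0 < rmax t) ->
  (push_all_cost alpha pick C rmax)%:R <= #|C|%:R + push_charge rmax.
Proof.
move=> r0; rewrite natr_sum -[in leRHS]sum1_card natr_sum -big_split /=.
apply: ler_sum => t tC; have rt := r0 t tC.
apply: le_trans (backward_push_cost_le alpha01 pick_ok _ rt) _.
by rewrite lerD2l ler_wpM2r ?invr_ge0 ?mulr_ge0 ?(ltW a0) ?(ltW rt) // ler_wpM2r // ler_nat.
Qed.

(** If [y > m], then [y - m] is at most [F] and at most [b], so its square is at most [D]. The claim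
    follows from [2 * x <= x ^+ 2 / z + z] with [x = y - m]. *)
Lemma balance_le (m F b D y z : R) : 0 < z -> 0 <= m -> 0 <= F -> 0 <= b ->
  F * b <= D -> y <= m + F -> y <= b -> y <= m + (D / z + z) / 2.
Proof.
move=> z0 m0 F0 b0 FbD yF yb; rewrite -lerBlDl.
have D0 : 0 <= D by apply: le_trans FbD; rewrite mulr_ge0.
rewrite ler_pdivlMr // -(ler_pM2r z0) [in leRHS]mulrDl divfK ?gt_eqF //.
have [y0|/ltW y0] := leP (y - m) 0.
  rewrite (@le_trans _ _ 0) // ?addr_ge0 ?mulr_ge0 ?(ltW z0) //.
  by rewrite mulr_le0_ge0 ?(ltW z0) // mulr_le0_ge0.
have yD : (y - m) * (y - m) <= D.
  apply: le_trans FbD; apply: ler_pM => //; first by rewrite lerBlDl.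
  by rewrite (le_trans _ yb) // gerBl.
have := sqr_ge0 (y - m - z); rewrite expr2; nra.
Qed.

Lemma walk_budget_ge0 nr : 0 <= walk_budget alpha s nr.
Proof. by rewrite !mulr_ge0 // mean_walk_cost_ge0. Qed.

Lemma walk_budget_half nr : walk_budget alpha s nr./2 <= 2^-1 * walk_budget alpha s nr.
Proof.
rewrite /walk_budget [leRHS]mulrA ler_wpM2r ?mean_walk_cost_ge0 //.
rewrite [leRHS]mulrCA ler_wpM2l // ler_pM2l // ler_pdivlMl // -natrM ler_nat.
by rewrite mul2n -[leqRHS]odd_double_half leq_addl.
Qed.

(* The work of every completed repetition, and the budget at the abort, are below
   both the budget b and #|C| + F, where F * b <= D throughout the loop. *)
Lemma phase2_loop_bound (D z Z : R) fuel j nr rmax cost :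
  let Y := #|C|%:R + (D / z + z) / 2 in
  C != finset.set0 -> 0 < z -> Y <= Z -> (nr < fuel)%N -> (nr < 2 ^ j)%N ->
  (forall t, t \in C -> 0 < rmax t) ->
  push_charge rmax * walk_budget alpha s nr <= D ->
  (push_all_cost alpha pick C rmax)%:R <= Z ->
  let x := phase2_loop alpha pick s fuel C nr rmax cost in
  [/\ walk_budget alpha s x.1.1 <= Y,
      (push_all_cost alpha pick C x.1.2)%:R <= Z &
      x.2%:R <= cost%:R + j.+1%:R * (2 * Y + 1)].
Proof.
move=> Y C0 z0 YZ; elim: fuel j nr rmax cost => [//|f IH] j nr rmax cost nrf nrj r0 FbD pZ /=.
have F0 := push_charge_ge0 r0; have b0 := walk_budget_ge0 nr.
have D0 : 0 <= D by apply: le_trans FbD; rewrite mulr_ge0.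
have CY : #|C|%:R <= Y by rewrite lerDl divr_ge0 // addr_ge0 ?divr_ge0 ?(ltW z0).
have Y0 : 0 <= Y := le_trans (ler0n _ _) CY.
have fullF := push_all_cost_half_le r0.
(* At an abort the balance is applied to the budget itself, which the test places below [full]; the
   cost of the repetition exceeds the budget by at most one unit. *)
case: ifP => [abort|/negbT].
  have bY : walk_budget alpha s nr <= Y.
    apply: (balance_le z0 _ F0 b0 FbD) => //.
    exact: le_trans (ltW abort) fullF.
  split=> //; rewrite natrD lerD2l -natr1.
  have tb : (Num.truncn (walk_budget alpha s nr))%:R <= walk_budget alpha s nr.
    by rewrite truncn_le.
  apply: (@le_trans _ _ (1 * (2 * Y + 1))); first by lra.
  by rewrite ler_wpM2r ?ler1n // addr_ge0 ?mulr_ge0.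
rewrite -leNgt => fullb.
have fullY : (full rmax)%:R <= Y by apply: (balance_le z0 _ F0 b0 FbD).
(* For [nr = 0] the budget is 0 while pushing costs at least one unit, so the repetition would have
   aborted. *)
have nr0 : (0 < nr)%N.
  rewrite lt0n; apply: contraTneq fullb => ->.
  rewrite /walk_budget !mulr0 mul0r -ltNge ltr0n.
  have [t tC] := finset.set0Pn _ C0.
  by rewrite /push_all_cost (bigD1 t) //= ltn_addr // backward_push_cost_gt0.
case: j nrj => [|j] nrj; first by move: nrj; rewrite expn0 ltnS leqNgt nr0.
have [||t tC|||bY' pZ' cY'] := IH j nr./2 (fun t => 2^-1 * rmax t) (cost + full rmax + #|C|.+1)%N.
- rewrite -ltnS (leq_trans _ nrf) // ltnS ltn_half_double -addnn -[ltnLHS]addn0.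
  by rewrite ltn_add2l.
- by rewrite ltn_half_double -mul2n -expnS.
- by rewrite mulr_gt0 // r0.
(* The charge doubles and the budget at least halves, as [nr./2] rounds down. *)
- rewrite push_charge_half; apply: le_trans FbD.
  apply: (@le_trans _ _ (2 * push_charge rmax * (2^-1 * walk_budget alpha s nr))).
    by rewrite ler_wpM2l ?mulr_ge0 // walk_budget_half.
  by rewrite mulrACA divff // mul1r.
(* The new thresholds are those at which the completed repetition has just pushed. *)
- exact: le_trans fullY YZ.
split=> //; apply: le_trans cY' _.
(* A completed repetition costs [full + #|C| + 1 <= 2 * Y + 1]. *)
rewrite !natrD -[in leRHS]natr1 -[#|C|.+1%:R]natr1 [in leRHS]mulrDl mul1r.
move: fullY CY; rewrite /full; lra.
Qed.

End Phase2.

(** * Rounding up *)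

Section NatCeil.
Variable R : realType.
Implicit Types x : R.

Lemma natceilE x : 0 <= x -> (natceil x)%:R = (Num.ceil x)%:~R :> R.
Proof.
move=> x0; rewrite /natceil -[RHS]/(_%:~R) natr_absz ger0_norm //.
by rewrite -(ler_int R) (le_trans x0) ?ceil_ge.
Qed.

Lemma natceil_ge x : 0 <= x -> x <= (natceil x)%:R.
Proof. by move=> x0; rewrite natceilE ?ceil_ge. Qed.

Lemma natceil_lt x : 0 <= x -> (natceil x)%:R < x + 1.
Proof.
by move=> x0; rewrite natceilE // -ltrBlDr; have /andP[+ _] := ceil_itv x; rewrite intrB.
Qed.

End NatCeil.

(* n * pagerank s / deg s; by reversibility it is also \sum_t ppr s t / deg t. *)
Definition inflow (R : realType) (alpha : R) (G : ugraph) (s : G) : R :=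
  (\sum_v ppr alpha v s) / (deg s)%:R.

(** * Cost for a fixed source and a fixed seed of RBS *)

Section PerSource.
Variables (R : realType) (alpha : R) (Omega : Type) (rbs : rbs_routine R Omega).
Variables (pm : power_routine R) (tau : nat -> nat).
Variables (G : ugraph) (pick : push_rule G) (eps : R) (s : G) (w : Omega).
Hypotheses (alpha01 : 0 < alpha < 1) (pick_ok : push_rule_ok pick) (eps0 : 0 < eps).
Let a0 : 0 < alpha. Proof. by case/andP: alpha01. Qed.
Let d0 (v : G) : 0 < (deg v)%:R :> R. Proof. by rewrite ltr0n deg_gt0. Qed.

Let C := candidates alpha rbs eps s w.
Let T := nt R G.

Definition candidate_mass : R := \sum_(t in C) ppr1 alpha rbs eps s w t / (deg t)%:R.

Lemma candidate_gt t : t \in C -> 2^-1 * eps < ppr1 alpha rbs eps s w t / (deg t)%:R.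
Proof. by rewrite inE. Qed.

Lemma candidate_ppr1_gt0 t : t \in C -> 0 < ppr1 alpha rbs eps s w t.
Proof.
move=> /candidate_gt; have e2 : 0 < 2^-1 * eps by rewrite mulr_gt0.
by move=> /(lt_trans e2); rewrite pmulr_lgt0 // invr_gt0.
Qed.

(** Each candidate contributes more than [eps / 2] to the mass. *)
Lemma card_candidates_le : #|C|%:R <= 2 * candidate_mass / eps.
Proof.
rewrite ler_pdivlMr // -sum1_card natr_sum mulr_suml mulr_sumr.
apply: ler_sum => t /candidate_gt /ltW; lra.
Qed.

(* RBS returns at most ppr t s + delta < 2 * delta when ppr t s < delta, so
   every candidate t has ppr t s >= delta, and its relative error is 1/2. *)
Lemma candidate_mass_le :
  rbs_accurate alpha s 2^-1 (4^-1 * eps * (deg s)%:R) (phase1 alpha rbs eps s w).1 ->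
  candidate_mass <= 3 / 2 * inflow alpha s.
Proof.
move=> acc; rewrite /inflow mulrA mulr_sumr mulr_suml.
apply: (@le_trans _ _ (\sum_(t in C) 3 / 2 * ppr alpha t s / (deg s)%:R)).
  apply: ler_sum => t tC.
  have E : ppr1 alpha rbs eps s w t / (deg t)%:R = (phase1 alpha rbs eps s w).1 t / (deg s)%:R.
    by rewrite /ppr1; field; rewrite !gt_eqF.
  have := candidate_gt tC; rewrite E ltr_pdivlMr // => big.
  rewrite ler_pM2r ?invr_gt0 //.
  have [accG accL] := acc t.
  have [large|small] := leP (4^-1 * eps * (deg s)%:R) (ppr alpha t s).
    have := le_trans (ler_norm _) (accG large); lra.
  by have := accL small; nra.
rewrite [leRHS](bigID (mem C)) /= lerDl sumr_ge0 // => t _.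
by rewrite divr_ge0 // mulr_ge0 // ppr_ge0.
Qed.

Lemma order_ge1 : 1 <= (order_of G)%:R :> R.
Proof. by rewrite ler1n ltnW // order_gt1. Qed.

(** Serves to weaken [1 / (eps ^+ 2 * nr_init)] to [1 / eps] in the push cost at the initial
    thresholds. *)
Lemma nr_init_ge : 1 <= eps * (nr_init G eps)%:R.
Proof.
rewrite -ler_pdivrMl // mulr1 (le_trans _ (natceil_ge _)) ?divr_ge0 ?(ltW eps0) //.
by rewrite -[leLHS]mul1r ler_pM2r ?invr_gt0 // order_ge1.
Qed.

Let nr0 : 0 < (nr_init G eps)%:R :> R.
Proof. by have := lt_le_trans ltr01 nr_init_ge; rewrite pmulr_rgt0. Qed.

Lemma rmax_init_gt0 t : t \in C -> 0 < rmax_init alpha rbs eps s w t.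
Proof.
move=> /candidate_ppr1_gt0 p0; apply: divr_gt0; first by rewrite !mulr_gt0 ?exprn_gt0.
by rewrite pmulr_rgt0.
Qed.

(** The threshold contains [deg t] squared and the charge one [deg t], so [ppr1 t / deg t] remains;
    24 is the 4 of the charge times the 6 of the threshold. *)
Lemma push_charge_init :
  push_charge alpha C (rmax_init alpha rbs eps s w) =
  24 * candidate_mass / (alpha * eps ^+ 2 * (nr_init G eps)%:R).
Proof.
rewrite mulr_sumr mulr_suml; apply: eq_bigr => t tC; rewrite /rmax_init.
by field; rewrite !gt_eqF // candidate_ppr1_gt0.
Qed.

Variables (A z : R) (j : nat).
Hypotheses (massA : candidate_mass <= A) (z0 : 0 < z) (nrj : (nr_init G eps < 2 ^ j)%N).

(* 2 * A / eps bounds #|C|, and 12 * A * T / (alpha * eps)^2 bounds the product of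
   push charge and walk budget, which does not grow along the loop. *)
Definition loop_work : R :=
  2 * A / eps + (12 * A * T%:R / (alpha ^+ 2 * eps ^+ 2) / z + z) / 2.
Definition push_work : R := loop_work + 24 * A / (alpha * eps).

Let mass0 : 0 <= candidate_mass.
Proof. by apply: sumr_ge0 => t tC; rewrite divr_ge0 // ltW // candidate_ppr1_gt0. Qed.
Let A0 : 0 <= A. Proof. exact: le_trans mass0 massA. Qed.

Lemma card_le_loop_work : #|C|%:R <= loop_work.
Proof.
rewrite (le_trans card_candidates_le) //.
apply: (@le_trans _ _ (2 * A / eps)); first by rewrite ler_pM2r ?invr_gt0 // ler_pM2l.
by rewrite lerDl divr_ge0 // addr_ge0 ?(ltW z0) // !divr_ge0 ?mulr_ge0 ?exprn_ge0 ?(ltW z0) ?(ltW a0) ?(ltW eps0).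
Qed.

Lemma loop_le_push_work : loop_work <= push_work.
Proof. by rewrite lerDl divr_ge0 ?mulr_ge0 ?(ltW a0) ?(ltW eps0). Qed.

Let Y0 : 0 <= loop_work. Proof. exact: le_trans (ler0n _ _) card_le_loop_work. Qed.

Lemma phase2_bound :
  [/\ walk_budget alpha s (nr_final alpha rbs pick eps s w) <= loop_work,
      (push_all_cost alpha pick C (rmax_final alpha rbs pick eps s w))%:R <= push_work &
      (phase2 alpha rbs pick eps s w).2%:R <= j.+1%:R * (2 * loop_work + 1)].
Proof.
(* Without candidates [phase2] returns 0 walks and cost 0, and the sum of push costs is empty. *)
rewrite /nr_final /rmax_final /phase2 -/C; case: ifPn => [/eqP C0|C0].
  rewrite /= /walk_budget !mulr0 mul0r /push_all_cost C0 big_set0.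
  by rewrite (le_trans Y0 loop_le_push_work) mulr_ge0 // addr_ge0 // mulr_ge0.
set D := 12 * A * T%:R / (alpha ^+ 2 * eps ^+ 2).
have e2 : 0 < alpha * eps ^+ 2 * (nr_init G eps)%:R by rewrite !mulr_gt0 ?exprn_gt0.
have charge_le : push_charge alpha C (rmax_init alpha rbs eps s w) <=
    24 * A / (alpha * eps ^+ 2 * (nr_init G eps)%:R).
  by rewrite push_charge_init ler_pM2r ?invr_gt0 // ler_pM2l.
have YZ : #|C|%:R + (D / z + z) / 2 <= loop_work.
  rewrite lerD2r (le_trans card_candidates_le) // ler_pM2r ?invr_gt0 // ler_pM2l //.
have [|||bY pZ cY] := @phase2_loop_bound R alpha G pick s alpha01 pick_ok C D z push_work
  (nr_init G eps).+1 j (nr_init G eps) (rmax_init alpha rbs eps s w) 0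
  C0 z0 (le_trans YZ loop_le_push_work) (ltnSn _) nrj.
- exact: rmax_init_gt0.
(* In charge times budget [nr_init] cancels, and 24 / 2 = 12; the second factor [1 / alpha] bounds
   the mean walk cost. *)
- apply: (@le_trans _ _ (24 * A / (alpha * eps ^+ 2 * (nr_init G eps)%:R) *
      (T%:R * (2^-1 * (nr_init G eps)%:R) * alpha^-1))).
    apply: ler_pM => //.
    + by apply: (push_charge_ge0 alpha01) => t; apply: rmax_init_gt0.
    + exact: walk_budget_ge0.
    by rewrite ler_wpM2l ?mulr_ge0 // mean_walk_cost_le.
  by rewrite le_eqVlt; apply/orP; left; apply/eqP; rewrite /D; field; rewrite !gt_eqF.
- apply: le_trans (push_all_cost_le alpha01 pick_ok rmax_init_gt0) _.
  apply: lerD; first exact: card_le_loop_work.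
  apply: (le_trans charge_le); rewrite ler_pdivrMr // mulrAC ler_pdivlMr ?mulr_gt0 //.
  have -> : 24 * A * (alpha * eps ^+ 2 * (nr_init G eps)%:R) =
     24 * A * (alpha * eps) * (eps * (nr_init G eps)%:R) by ring.
  by rewrite ler_peMr ?nr_init_ge // !mulr_ge0 ?(ltW a0) ?(ltW eps0).
split=> //; first exact: le_trans bY YZ.
apply: (le_trans cY); rewrite add0r ler_wpM2l // lerD2r ler_pM2l //.
Qed.

(** The budget prices [nt * (nr / 2)] walks, and phase III simulates [nt * nr]. *)
Lemma walks_bound :
  #|{: 'I_T * 'I_(nr_final alpha rbs pick eps s w)}|%:R * mean_walk_cost alpha s
  <= 2 * loop_work.
Proof.
have [bY _ _] := phase2_bound.
rewrite card_prod !card_ord natrM; move: bY; rewrite /walk_budget -/T; lra.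
Qed.

(** The loop, the final pushes, and the sums and selections of phase III; phase I and the walks are
    counted apart. *)
Definition source_work : R :=
  j.+1%:R * (2 * loop_work + 1) + push_work + T%:R * (3 * push_work).

Lemma unguarded_cost_le (ws : batch alpha rbs pick eps s w) :
  (unguarded ws).2%:R <=
    (phase1_cost alpha rbs eps s w)%:R + source_work + \sum_x (walk_cost (ws x))%:R.
Proof.
have [_ pZ cY] := phase2_bound.
rewrite /= /phase2_cost /phase3_cost !natrD -natr_sum -/C -/T !natrM.
have sum_le : (\sum_(t in C) (nnz (residue (push_final alpha rbs pick eps s w t))).+1)%:R
    <= 2 * push_work.
  rewrite (le_trans _ (ler_wpM2l _ pZ)) // -natrM ler_nat big_distrr /=.
  apply: leq_sum => t _; rewrite mul2n -addnn -addn1 leq_add ?nnz_backward_push //.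
  exact: backward_push_cost_gt0.
have CY : #|C|%:R <= push_work := le_trans card_le_loop_work loop_le_push_work.
have := ler_wpM2l (ler0n R T) sum_le; have := ler_wpM2l (ler0n R T) CY.
rewrite /source_work; lra.
Qed.

Variable Q : R.
Hypotheses (Q1 : 1 <= Q)
  (guardQ : (tau (order_of G))%:R + (@pm G alpha s eps).2%:R <= Q * (tau (order_of G))%:R).

(** When the safeguard fires, the unguarded cost is at least [tau n], and the actual cost is at most
    [Q * tau n]. *)
Lemma algorithmD_cost_le (ws : batch alpha rbs pick eps s w) :
  (algorithmD pm tau ws).2%:R <= Q * (unguarded ws).2%:R.
Proof.
rewrite /algorithmD; case: ifPn => [_|]; first by rewrite ler_peMl.
rewrite -leqNgt natrD => le_tau; apply: (le_trans guardQ).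
by rewrite ler_wpM2l ?(le_trans ler01) // ler_nat.
Qed.

(** Once the seed is fixed, the cost bound depends on the walks only through their total length. *)
Lemma expected_walk_time_le :
  (\esum_(ws in [set: batch alpha rbs pick eps s w])
     (batch_prob alpha s ws * (algorithmD pm tau ws).2%:R)%:E
   <= (Q * ((phase1_cost alpha rbs eps s w)%:R + source_work + 2 * loop_work))%:E)%E.
Proof.
have Q0 : 0 <= Q := le_trans ler01 Q1.
have W0 : 0 <= source_work.
  have Z0 := le_trans Y0 loop_le_push_work.
  have : 0 <= j.+1%:R * (2 * loop_work + 1) by rewrite mulr_ge0 // addr_ge0 // mulr_ge0.
  have : 0 <= T%:R * (3 * push_work) by rewrite mulr_ge0 // mulr_ge0.
  by rewrite /source_work; lra.
set c := (phase1_cost alpha rbs eps s w)%:R + source_work.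
have c0 : 0 <= c by rewrite addr_ge0.
apply: (@le_trans _ _ (\esum_(ws in [set: batch alpha rbs pick eps s w])
    (batch_prob alpha s ws * (Q * c + Q * \sum_x (walk_cost (ws x))%:R))%:E)%E).
  apply: le_esum => ws _; rewrite lee_fin ler_wpM2l ?batch_prob_ge0 //.
  apply: le_trans (algorithmD_cost_le ws) _; rewrite -mulrDr ler_wpM2l //.
  exact: unguarded_cost_le.
apply: le_trans (esum_batch_le _ _ alpha01 _ Q0) _; first by rewrite mulr_ge0.
by rewrite lee_fin -mulrDr ler_wpM2l // lerD2l walks_bound.
Qed.

End PerSource.

(** * The cost ceiling given by the safeguard, for any seed *)

Section GuardedCost.
Variables (R : realType) (alpha : R) (Omega : Type) (rbs : rbs_routine R Omega).
Variables (pm : power_routine R) (tau : nat -> nat).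
Variables (G : ugraph) (pick : push_rule G) (eps : R) (s : G) (w : Omega).
Hypotheses (alpha01 : 0 < alpha < 1).

Lemma algorithmD_cost_guard (ws : batch alpha rbs pick eps s w) :
  ((algorithmD pm tau ws).2 <= tau (order_of G) + (@pm G alpha s eps).2)%N.
Proof.
by rewrite /algorithmD; case: ifP => // /ltnW le_tau; rewrite (leq_trans le_tau) ?leq_addr.
Qed.

Lemma expected_walk_time_guard :
  (\esum_(ws in [set: batch alpha rbs pick eps s w])
     (batch_prob alpha s ws * (algorithmD pm tau ws).2%:R)%:E
   <= ((tau (order_of G))%:R + (@pm G alpha s eps).2%:R)%:E)%E.
Proof.
set c := _ + _; apply: (@le_trans _ _ (\esum_(ws in [set: batch alpha rbs pick eps s w])
    (batch_prob alpha s ws * (c + 0 * \sum_x (walk_cost (ws x))%:R))%:E)%E).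
  apply: le_esum => ws _; rewrite lee_fin mul0r addr0 ler_wpM2l ?batch_prob_ge0 //.
  by rewrite /c -natrD ler_nat algorithmD_cost_guard.
apply: le_trans (esum_batch_le _ _ alpha01 _ (lexx 0)) _; first by rewrite addr_ge0.
by rewrite mul0r addr0.
Qed.

End GuardedCost.

(** * Averaging over the seed of RBS *)

Section SeedExpectation.
Context d (T : measurableType d) (R : realType) (P : probability T R).

Lemma ge0_le_integral_nomeas (f g : T -> \bar R) :
  (forall x, (0 <= f x)%E) -> (forall x, (f x <= g x)%E) ->
  (\int[P]_x f x <= \int[P]_x g x)%E.
Proof.
move=> f0 fg; have g0 x : (0 <= g x)%E := le_trans (f0 x) (fg x).
rewrite !ge0_integralTE //; apply: le_ereal_sup => _ [h hf <-].
by exists h => // x; apply: le_trans (hf x) (fg x).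
Qed.

(** Everywhere [f] is at most [q * g + c] plus [b] times the indicator of the complement of [A], and
    this bound is measurable. *)
Lemma integral_split_le (f : T -> \bar R) (g : T -> R) (A : set T) (q c b e p : R) :
  measurable A -> measurable_fun [set: T] g -> (forall x, 0 <= g x) ->
  0 <= q -> 0 <= c -> 0 <= b ->
  (forall x, (0 <= f x)%E) ->
  (forall x, A x -> (f x <= (q * g x + c)%:E)%E) ->
  (forall x, (f x <= b%:E)%E) ->
  (\int[P]_x (g x)%:E <= e%:E)%E -> ((1 - p)%:E <= P A)%E ->
  (\int[P]_x f x <= (q * e + c + b * p)%:E)%E.
Proof.
move=> mA mg g0 q0 c0 b0 f0 fA fb intg PA.
have mAc : measurable (~` A) by apply: measurableC.
have mge : measurable_fun [set: T] (fun x => (g x)%:E : \bar R) by apply/measurable_EFinP.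
have m1 : measurable_fun [set: T] (fun x => q%:E * (g x)%:E)%E by apply: measurable_funeM.
have mind : measurable_fun [set: T] (fun x => (\1_(~` A) x : R)%:E).
  by apply/measurable_EFinP; apply: measurable_indic.
have m2 : measurable_fun [set: T] (fun x => b%:E * (\1_(~` A) x : R)%:E)%E by apply: measurable_funeM.
have p1 x : (0 <= q%:E * (g x)%:E)%E by rewrite mule_ge0 ?lee_fin.
have p2 x : (0 <= b%:E * (\1_(~` A) x : R)%:E)%E by rewrite mule_ge0 ?lee_fin.
apply: (@le_trans _ _ (\int[P]_x ((q%:E * (g x)%:E + c%:E) + b%:E * (\1_(~` A) x : R)%:E))%E).
  apply: ge0_le_integral_nomeas => // x.
  have [xA|xA] := pselect (A x).
    by rewrite (le_trans (fA x xA)) // EFinD EFinM leeDl.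
  rewrite (le_trans (fb x)) // indicE mem_set // mule1 leeDr //.
  by rewrite adde_ge0 ?p1 // lee_fin.
rewrite ge0_integralD //; last 2 first.
- by move=> x _; rewrite adde_ge0 ?p1 // lee_fin.
- by apply: emeasurable_funD => //; apply: measurable_cst.
rewrite ge0_integralD //.
rewrite ge0_integralZl_EFin //; last by move=> x _; rewrite lee_fin.
rewrite ge0_integralZl_EFin //.
have -> : (\int[P]_x c%:E = c%:E)%E.
  apply: etrans (integral_cst P measurableT c%:E) _.
  by rewrite -[RHS]mule1; congr (_ * _)%E; exact: probability_setT.
have -> : (\int[P]_x (\1_(~` A) x : R)%:E = 1 - P A)%E.
  by rewrite integral_indic // setIT; exact: probability_setC.
rewrite !EFinD !EFinM; apply: leeD; first apply: leeD => //.
  by rewrite lee_pmul ?lee_fin // integral_ge0 // => x _; rewrite lee_fin.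
rewrite lee_wpmul2l ?lee_fin //.
move: PA; rewrite -(@fineK _ (P A)) ?fin_num_measure // lee_fin -EFinB lee_fin; lra.
Qed.

(** For each of the finitely many nodes, accuracy confines the estimate to a fixed interval. *)
Lemma measurable_rbs_accurate (G : ugraph) (alpha : R) (t : G) (epsr delta : R)
    (est : T -> G -> R) :
  (forall v, measurable_fun [set: T] (fun x => est x v)) ->
  measurable [set x | rbs_accurate alpha t epsr delta (est x)].
Proof.
move=> mest.
have -> : [set x | rbs_accurate alpha t epsr delta (est x)] =
    \bigcap_(v in [set: G]) ([set: T] `&` (fun x => est x v) @^-1`
      (if delta <= ppr alpha v t then
        [set` `[ppr alpha v t - epsr * ppr alpha v t, ppr alpha v t + epsr * ppr alpha v t]]
       else [set` `]-oo, ppr alpha v t + delta]])).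
  apply/seteqP; split=> x /= acc v.
    move=> _; split=> //; have [accG accL] := acc v.
    have [large|small] := leP delta (ppr alpha v t); rewrite /= in_itv /=.
      by have := accG large; rewrite ler_distl.
    exact: accL.
  have [_ /=] := acc v I.
  by have [large|small] := leP delta (ppr alpha v t); rewrite /= in_itv /= => h;
    split => // _; rewrite ler_distl.
apply: fin_bigcap_measurable; first exact: finite_finset.
by move=> v _; apply: mest => //; case: ifP.
Qed.

End SeedExpectation.

(** * Logarithmic factors *)

Section Logarithms.
Variables (R : realType).

(** Taking [x = - 1/2] in [ln (1 + x) <= x] gives [ln 2 >= 1/2]. Since [2 * ln n] is at least 1,
    constants can be absorbed into its powers. *)
Lemma ln_nat_ge (n : nat) : (1 < n)%N -> 1 <= 2 * ln n%:R :> R.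
Proof.
move=> n1; have ln2 : 2^-1 <= ln 2 :> R.
  have := @le_ln1Dx R (- 2^-1); rewrite (_ : 1 + - 2^-1 = 2^-1); last by lra.
  by rewrite lnV ?posrE // => /(_ _); move=> h; rewrite -lerN2 h //; lra.
have : ln 2 <= ln n%:R :> R by rewrite ler_ln ?posrE ?ltr0n ?ler_nat // ltnW.
lra.
Qed.

(** Here [ln (2 * n ^+ 2) <= 3 * ln n], and rounding adds at most [1 <= 2 * ln n]; 18 * 3 + 2 = 28 *
    2. *)
Lemma nt_le (G : ugraph) : (1 < order_of G)%N ->
  (nt R G)%:R <= 28 * (2 * ln (order_of G)%:R) :> R.
Proof.
move=> n1; have L1 := ln_nat_ge n1.
have n0 : 0 < (order_of G)%:R :> R by rewrite ltr0n ltnW.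
have n2 : 2 <= (order_of G)%:R :> R by rewrite (ler_nat R 2).
have E : ln (2 * (order_of G)%:R ^+ 2) = ln 2 + ln (order_of G)%:R *+ 2 :> R.
  by rewrite lnM ?posrE ?exprn_gt0 // lnXn.
have ln2 : ln 2 <= ln (order_of G)%:R :> R by rewrite ler_ln ?posrE.
have ln20 : 0 <= ln 2 :> R by rewrite ln_ge0 // ler1n.
apply: le_trans (ltW (natceil_lt _)) _; rewrite E mulr2n; lra.
Qed.

(** For such [eps], [n / eps <= n ^+ 4], so about [4 * log2 n] halvings exhaust [nr_init]. *)
Lemma nr_init_log (G : ugraph) (eps : R) : (1 < order_of G)%N -> 0 < eps ->
  (order_of G)%:R ^- 3 <= eps ->
  exists j, (nr_init G eps < 2 ^ j)%N /\ j.+1%:R <= 10 * (2 * ln (order_of G)%:R) :> R.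
Proof.
set n := order_of G => n1 eps0 le_eps.
have n0 : 0 < n%:R :> R by rewrite ltr0n ltnW.
pose a := up_log 2 n; have na : (n <= 2 ^ a)%N by apply: up_logP.
exists (4 * a).+1; split.
  rewrite expnS -(ltr_nat R).
  apply: (lt_le_trans (natceil_lt _)); first by rewrite divr_ge0 ?(ltW eps0).
  apply: (@le_trans _ _ (n%:R ^+ 4 + 1)).
    rewrite lerD2r ler_pdivrMr // exprS -mulrA ler_peMr ?(ltW n0) //.
    by rewrite -ler_pdivrMl ?exprn_gt0 // mulr1.
  rewrite mul2n -addnn natrD lerD // ?ler1n ?expn_gt0 //.
  by rewrite mulnC expnM -natrX ler_nat leq_exp2r.
have L1 := ln_nat_ge n1.
have : a.-1%:R * ln 2 <= ln n%:R :> R.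
  rewrite mulr_natl -lnXn // ler_ln ?posrE ?exprn_gt0 // -natrX ler_nat ltnW //.
  exact: up_log_gtn.
have ln2 : 1 <= 2 * ln 2 :> R by apply: (@ln_nat_ge 2).
have a0 : (0 < a)%N by rewrite up_log_gt0 n1.
(* [a - 1] is at most [2 * ln n], so the sum is at most 4 + 6 = 10 times [2 * ln n]. *)
have -> : (4 * a).+2%:R = 4 * a.-1%:R + 6 :> R.
  by rewrite -{1}(prednK a0) -natrM -natrD; congr _%:R; lia.
have : 0 <= a.-1%:R :> R by [].
nra.
Qed.

End Logarithms.

(** * Averaging over the source *)

Section Averages.
Variables (R : realType) (alpha : R) (G : ugraph).
Hypothesis alpha01 : 0 < alpha < 1.

Lemma source_inflow (s : G) :
  source_prob R s * inflow alpha s = (\sum_v ppr alpha v s) / (2 * (size_of G)%:R).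
Proof.
rewrite /source_prob /inflow mulrC mulrA divfK //.
by rewrite pnatr_eq0 -lt0n deg_gt0.
Qed.

(** The degree in the source distribution cancels that in [inflow]; exchanging the sums leaves [n]
    rows of total 1. *)
Lemma sum_source_inflow :
  \sum_(s : G) source_prob R s * inflow alpha s = (order_of G)%:R / (2 * (size_of G)%:R).
Proof.
under eq_bigr do rewrite source_inflow.
rewrite -mulr_suml exchange_big /=; congr (_ / _).
by under eq_bigr do rewrite sum_ppr //; rewrite sumr_const.
Qed.

Lemma inflow_ge0 (s : G) : 0 <= inflow alpha s.
Proof. by rewrite divr_ge0 // sumr_ge0 // => v _; apply: ppr_ge0. Qed.

Lemma sum_ppr_deg (s : G) : \sum_t ppr alpha s t / (deg t)%:R = inflow alpha s.
Proof.
rewrite /inflow mulr_suml; apply: eq_bigr => t _.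
have d0 (v : G) : (deg v)%:R != 0 :> R by rewrite pnatr_eq0 -lt0n deg_gt0.
have := ppr_reversible alpha01 s t => E.
by apply/eqP; rewrite eqr_div ?d0 // mulrC E mulrC.
Qed.

End Averages.

(** * Expected time for a fixed source *)

Section SourceTime.
Variables (R : realType) (alpha : R) (d : measure_display) (Omega : measurableType d).
Variables (P : probability Omega R) (rbs : rbs_routine R Omega).
Variables (pm : power_routine R) (tau : nat -> nat).
Variables (G : ugraph) (pick : push_rule G) (eps : R) (s : G).
Hypotheses (alpha01 : 0 < alpha < 1) (rbsP : rbs_spec P rbs).
Hypotheses (pick_ok : push_rule_ok pick) (eps0 : 0 < eps).
Let n : R := (order_of G)%:R.
Let L : R := 2 * ln n.
Variables (Q B : R).
Hypothesis guardB : (tau (order_of G))%:R + (@pm G alpha s eps).2%:R <= B * n ^+ 2.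

Let B0 : 0 <= B.
Proof.
have n0 : 0 < n ^+ 2 by rewrite exprn_gt0 // (lt_le_trans ltr01 (order_ge1 R s)).
by rewrite -(pmulr_lge0 _ n0) (le_trans _ guardB) // addr_ge0.
Qed.

Lemma expected_time_guard : (expected_time alpha P rbs pm tau pick eps s <= (B * n ^+ 2)%:E)%E.
Proof.
apply: (@le_trans _ _ (\int[P]_w (B * n ^+ 2)%:E)%E).
  apply: ge0_le_integral_nomeas => w.
    by apply: esum_ge0 => ws _; rewrite lee_fin mulr_ge0 // batch_prob_ge0.
  by apply: le_trans (expected_walk_time_guard _ _ _ _ _ _ _ alpha01) _; rewrite lee_fin.
rewrite le_eqVlt; apply/orP; left; apply/eqP.
apply: etrans (integral_cst P measurableT _) _.
by rewrite -[RHS]mule1; congr (_ * _)%E; exact: probability_setT.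
Qed.

Hypotheses (Q1 : 1 <= Q)
  (guardQ : (tau (order_of G))%:R + (@pm G alpha s eps).2%:R <= Q * (tau (order_of G))%:R).
Hypothesis eps_large : n ^- 3 <= eps.
Variables (e z : R).
Hypotheses (z0 : 0 < z)
  (rbs_le : (\int[P]_w ((phase1 alpha rbs eps s w).2%:R)%:E <= e%:E)%E).

(** [push_work] at [A = 3/2 * inflow], with [nt] replaced by its bound [28 * L]: 252 = 9 * 28. *)
Definition source_budget : R :=
  (3 + 36 / alpha) * (inflow alpha s / eps) +
  252 * L / alpha ^+ 2 * (inflow alpha s / (eps ^+ 2 * z)) + z / 2.

Lemma expected_time_le :
  (expected_time alpha P rbs pm tau pick eps s <=
   (Q * (2 * e + 110 * L * (source_budget + 1)) + B)%:E)%E.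
Proof.
have /andP[a0 a1] := alpha01.
have n1 : (1 < order_of G)%N := order_gt1 s.
have n0 : 0 < n by rewrite ltr0n ltnW.
have L1 : 1 <= L := ln_nat_ge R n1.
have Q0 : 0 <= Q := le_trans ler01 Q1.
have I0 := inflow_ge0 alpha01 s.
have [j [nrj jL]] := nr_init_log n1 eps0 eps_large.
have T28 := nt_le R n1; rewrite -/n -/L in T28 jL.
pose A := 3 / 2 * inflow alpha s; have A0 : 0 <= A by rewrite mulr_ge0.
pose Y := loop_work alpha G eps A z; pose Z := push_work alpha G eps A z.
have Y0 : 0 <= Y.
  have ez0 := ltW z0; rewrite /Y /loop_work; apply: addr_ge0.
    by apply: divr_ge0 (ltW eps0); rewrite mulr_ge0.
  apply: divr_ge0 => //; apply: addr_ge0 => //; apply: divr_ge0 => //.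
  apply: divr_ge0; last by rewrite mulr_ge0 // exprn_ge0 // ltW.
  by rewrite mulr_ge0 // mulr_ge0.
have YZ : Y <= Z.
  rewrite /Z /push_work lerDl; apply: divr_ge0; first by rewrite mulr_ge0.
  by rewrite mulr_ge0 ?(ltW a0) ?(ltW eps0).
have ZH : Z <= source_budget.
  have E : Z = (3 + 36 / alpha) * (inflow alpha s / eps) +
      9 * (nt R G)%:R / alpha ^+ 2 * (inflow alpha s / (eps ^+ 2 * z)) + z / 2.
    by rewrite /Z /push_work /loop_work /A; field; rewrite !gt_eqF.
  rewrite E lerD2r lerD2l ler_wpM2r //.
    by rewrite divr_ge0 // mulr_ge0 ?exprn_ge0 ?(ltW z0) ?(ltW eps0).
  by rewrite ler_wpM2r ?invr_ge0 ?exprn_ge0 ?(ltW a0) //; lra.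
(* The coefficient of [L * Z] is at most 20 + 84 + 3 = 107, and the constant term is [10 * L]. *)
have work_le : source_work alpha G eps A z j + 2 * Y <= 110 * L * (source_budget + 1).
  rewrite /source_work -/Y -/Z.
  have Z0 : 0 <= Z := le_trans Y0 YZ.
  have h1 : j.+1%:R * (2 * Y + 1) <= 10 * L * (2 * Z + 1).
    by apply: ler_pM => //; [rewrite addr_ge0 // mulr_ge0|lra].
  have h2 : (nt R G)%:R * (3 * Z) <= 28 * L * (3 * Z) by rewrite ler_wpM2r // mulr_ge0.
  have h3 : Z <= L * Z by rewrite ler_peMl.
  have h4 : L * Z <= L * source_budget by rewrite ler_wpM2l // (le_trans ler01).
  nra.
have W0 : 0 <= source_work alpha G eps A z j + 2 * Y.
  have Z0 : 0 <= Z := le_trans Y0 YZ.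
  have h1 : 0 <= j.+1%:R * (2 * Y + 1) by rewrite mulr_ge0 // addr_ge0 // mulr_ge0.
  have h2 : 0 <= (nt R G)%:R * (3 * Z) by rewrite mulr_ge0 // mulr_ge0.
  by rewrite /source_work -/Y -/Z; lra.
pose acc := [set w | rbs_accurate alpha s 2^-1 (4^-1 * eps * (deg s)%:R)
                       (phase1 alpha rbs eps s w).1].
(* RBS fails with probability at most [n ^- 2] and then costs at most [B * n ^+ 2]. Reading its
   output at most doubles the cost of phase I, whence [2 * Q * e]. *)
have bound : (expected_time alpha P rbs pm tau pick eps s <=
    (2 * Q * e + Q * (source_work alpha G eps A z j + 2 * Y) + B * n ^+ 2 * n ^- 2)%:E)%E.
  apply: (@integral_split_le _ _ _ P _ (fun w => (phase1 alpha rbs eps s w).2%:R) acc) => //.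
  - by apply: measurable_rbs_accurate => v; apply: (rbs_est_measurable rbsP).
  - exact: (rbs_time_measurable rbsP).
  - by rewrite mulr_ge0.
  - by rewrite mulr_ge0.
  - by rewrite mulr_ge0 ?exprn_ge0 ?(ltW n0).
  - by move=> w; apply: esum_ge0 => ws _; rewrite lee_fin mulr_ge0 // batch_prob_ge0.
  - move=> w accw.
    have massA : candidate_mass alpha rbs eps s w <= A by apply: candidate_mass_le.
    have h := expected_walk_time_le alpha01 pick_ok eps0 massA z0 nrj Q1 guardQ.
    apply: le_trans h _.
    rewrite lee_fin -/A -/Y -[2 * Q]mulrC -mulrA -mulrDr ler_wpM2l // -addrA lerD2r.
    rewrite /phase1_cost natrD mulr_natl mulr2n lerD2l ler_nat.
    exact: (rbs_output_size rbsP).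
  - by move=> w; apply: le_trans (expected_walk_time_guard _ _ _ _ _ _ _ alpha01) _; rewrite lee_fin.
  apply: (rbs_correct rbsP) => //; first by rewrite !mulr_gt0 // ltr0n deg_gt0.
  by rewrite invr_gt0 exprn_gt0 //= invf_lt1 ?exprn_gt0 // exprn_egt1 // ltr1n.
apply: le_trans bound _; rewrite lee_fin mulfK ?gt_eqF ?exprn_gt0 // lerD2r.
have := ler_wpM2l Q0 work_le; lra.
Qed.

End SourceTime.

(** * Collecting the polylogarithmic factors and conclusion *)

Lemma soft_bound_le (R : realType) (K : R) k n f : (1 < n)%N ->
  soft_bound K k n f <= `|K| * (2 * ln n%:R) ^+ k * Num.max 1 f.
Proof.
move=> n1; have L1 := ln_nat_ge R n1; have l0 : 0 <= ln n%:R :> R by lra.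
rewrite /soft_bound ler_wpM2r ?le_max ?ler01 //.
(* [K] may be negative and [ln n] less than 1, so both are replaced by larger factors fit for
   further estimates. *)
apply: le_trans (ler_norm _) _; rewrite normrM ler_wpM2l // normrX ger0_norm //.
by rewrite lerXn2r ?nnegrE //; lra.
Qed.

(** With [c = sqrt (n / m)] and [w = z = c / eps], averaging [inflow] to [c ^+ 2 / 2] turns
    [inflow / eps] into [c * w / 2] and [inflow / (eps ^+ 2 * z)] into [w / 2]. The left side is the
    averaged work before [Q] and [B]. *)
Lemma averaged_work_le (R : realType) (a X L W c w : R) :
  0 < a -> 0 <= X -> 1 <= L -> 1 <= W -> 0 <= c <= 2 -> 0 <= w <= W ->
  2 * X + 110 * L * (w / 2 + 1) +
  (4 * X * (c * w) + 110 * L * ((3 + 36 / a) * (c * w) / 2 + 126 * L / a ^+ 2 * w))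
  <= 10 * X * W + 110 * L ^+ 2 * (5 + 36 / a + 126 / a ^+ 2) * W.
Proof.
move=> a0 X0 L1 W1 /andP[c0 c2] /andP[w0 wW].
have W0 := le_trans ler01 W1; have L0 := le_trans ler01 L1.
have cw : c * w <= 2 * W by apply: ler_pM.
have i0 : 0 <= 36 / a by rewrite divr_ge0 // ltW.
have j0 : 0 <= 126 / a ^+ 2 by rewrite divr_ge0 // exprn_ge0 // ltW.
rewrite [126 * L / _]mulrAC; set i := 36 / a in i0 *; set i2 := 126 / a ^+ 2 in j0 *.
have h1 : X * (c * w) <= X * (2 * W) by rewrite ler_wpM2l.
have h2 : X <= X * W by rewrite ler_peMr.
have h3 : (3 + i) * (c * w) <= (3 + i) * (2 * W) by rewrite ler_wpM2l // addr_ge0.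
have h4 : i2 * L * w <= i2 * L * W by rewrite ler_wpM2l // mulr_ge0.
have h5 : (w / 2 + 1) + ((3 + i) * (c * w) / 2 + i2 * L * w) <= L * (5 + i + i2) * W.
  have : (5 + i) * W <= L * ((5 + i) * W) by rewrite ler_peMl // mulr_ge0 // addr_ge0.
  by lra.
have : L * ((w / 2 + 1) + ((3 + i) * (c * w) / 2 + i2 * L * w)) <= L * (L * (5 + i + i2) * W).
  by rewrite ler_wpM2l.
by rewrite expr2; lra.
Qed.

(** The exponent adds [k2] from the safeguard ratio, [k1] from RBS and 2 from the work of the other
    phases. *)
Lemma polylog_collect (R : realType) (L W K1 K2 c1 c2 M : R) k1 k2 :
  1 <= L -> 1 <= W -> 0 <= K1 -> 0 <= K2 -> 0 < c1 -> 0 < c2 -> 0 <= M ->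
  (1 + K2 * L ^+ k2 / c1) * (10 * (K1 * L ^+ k1) * W + L ^+ 2 * M * W) +
    (c2 + K2 * L ^+ k2) * W
  <= ((1 + K2 / c1) * (10 * K1 + M) + (c2 + K2)) * L ^+ (k1 + k2 + 2) * W.
Proof.
move=> L1 W1 K10 K20 c10 c20 M0; have L0 := le_trans ler01 L1.
have W0 := le_trans ler01 W1.
have P0 k : 0 <= L ^+ k by rewrite exprn_ge0.
have P1 k : 1 <= L ^+ k by rewrite exprn_ege1.
have Pm k l : L ^+ k <= L ^+ (k + l) by rewrite exprD ler_peMr.
have q0 : 0 <= K2 / c1 by rewrite divr_ge0 // ltW.
have hQ : 1 + K2 * L ^+ k2 / c1 <= (1 + K2 / c1) * L ^+ k2.
  by rewrite mulrDl mul1r [K2 * _ / _]mulrAC lerD2r.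
have hX : 10 * (K1 * L ^+ k1) + L ^+ 2 * M <= (10 * K1 + M) * L ^+ (k1 + 2).
  rewrite [leRHS]mulrDl mulrA; apply: lerD; first by rewrite ler_wpM2l // mulr_ge0.
  by rewrite mulrC ler_wpM2l // addnC.
have hB : c2 + K2 * L ^+ k2 <= (c2 + K2) * L ^+ (k1 + k2 + 2).
  rewrite mulrDl lerD //; first by rewrite ler_peMr // ltW.
  by rewrite ler_wpM2l // -addnA addnCA.
rewrite -mulrDl mulrA -mulrDl ler_wpM2r // [leRHS]mulrDl lerD //.
apply: (@le_trans _ _ ((1 + K2 / c1) * L ^+ k2 * ((10 * K1 + M) * L ^+ (k1 + 2)))).
  apply: ler_pM => //; first by rewrite addr_ge0 // divr_ge0 ?mulr_ge0 // ltW.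
  by rewrite addr_ge0 // !mulr_ge0.
rewrite mulrACA -exprD le_eqVlt; apply/orP; left; apply/eqP.
by congr (_ * L ^+ _); rewrite addnA [(k2 + k1)%N]addnC.
Qed.

Theorem theorem21 (R : realType) (alpha : R)
    (d : measure_display) (Omega : measurableType d) (P : probability Omega R)
    (rbs : rbs_routine R Omega) (pm : power_routine R) (tau : nat -> nat)
    (alpha01 : 0 < alpha < 1)
    (rbsP : rbs_spec P rbs)
    (pmP : power_time alpha pm)
    (tauP : theta_square R tau) :
  (exists c1 c2 : R, [/\ 0 < c1, 0 < c2 &
     forall (G : ugraph) (eps : R), 0 < eps ->
       let f := eps^-1 * ((order_of G)%:R / (size_of G)%:R) in
       c1 * f <=
         \sum_(s : G) source_prob R s *
            (eps^-1 * \sum_(t : G) ppr alpha s t / (deg t)%:R)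
       <= c2 * f]) /\
  (exists (K : R) (k : nat),
     forall (G : ugraph) (pick : push_rule G) (eps : R),
       push_rule_ok pick -> 0 < eps ->
       (\sum_(s : G) (source_prob R s)%:E *
          expected_time alpha P rbs pm tau pick eps s <=
        (soft_bound K k (order_of G)
           (eps^-1 * Num.sqrt ((order_of G)%:R / (size_of G)%:R)))%:E)%E).
Proof.
have /andP[a0 a1] := alpha01; split.
  (* The average is exactly [n / (2 * m * eps)]. *)
  exists 2^-1, 2^-1; split; [by rewrite invr_gt0|by rewrite invr_gt0|].
  move=> G eps eps0 /=; set f := eps^-1 * (_ / _).
  under eq_bigr do rewrite sum_ppr_deg // mulrCA.
  rewrite -mulr_sumr sum_source_inflow // invfM.
  have -> : eps^-1 * ((order_of G)%:R * (2^-1 / (size_of G)%:R)) = 2^-1 * f by rewrite /f; ring.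
  by rewrite lexx.
have half0 : 0 < 2^-1 :> R by rewrite invr_gt0.
(* The exponent 2 matches the failure probability [n ^- 2] of phase I. *)
have [K1 [k1 rbs_le]] := rbs_time rbsP 2 alpha01 half0.
have [K2 [k2 pm_le]] := pmP.
have [c1 [c2 [c10 c20 tau_le]]] := tauP.
pose M : R := 110 * (5 + 36 / alpha + 126 / alpha ^+ 2).
have M0 : 0 <= M.
  by rewrite mulr_ge0 // !addr_ge0 ?divr_ge0 ?exprn_ge0 ?(ltW a0).
pose K : R := (1 + `|K2| / c1) * (10 * `|K1| + M) + (c2 + `|K2|).
have K0 : 0 <= K.
  apply: addr_ge0; last by rewrite addr_ge0 // ltW.
  apply: mulr_ge0; first by rewrite addr_ge0 // divr_ge0 // ltW.
  by apply: addr_ge0 M0; rewrite mulr_ge0.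
exists (K * 2 ^+ (k1 + k2 + 2)), (k1 + k2 + 2)%N => G pick eps pick_ok eps0.
(* A node would force [n > 1], so the sum is empty for [n <= 1]; since [ln 0] is 0 by convention,
   the bound is still nonnegative. *)
have [nle1|n1] := leqP (order_of G) 1.
  rewrite big1 => [|s _]; last by have := order_gt1 s; rewrite ltnNge nle1.
  rewrite lee_fin !mulr_ge0 ?exprn_ge0 ?le_max ?ler01 //.
  case: (order_of G) nle1 => [|[|//]] _; [by rewrite ln0|by rewrite ln1].
set c := Num.sqrt _; set W := Num.max 1 (eps^-1 * c).
set n : R := (order_of G)%:R; set m : R := (size_of G)%:R.
pose L : R := 2 * ln n.
rewrite (_ : soft_bound _ _ _ _ = K * L ^+ (k1 + k2 + 2) * W); last first.
  by rewrite /soft_bound /L exprMn !mulrA.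
have L1 : 1 <= L := ln_nat_ge R n1.
have n0 : 0 < n by rewrite ltr0n ltnW.
have m0 : 0 < m by rewrite ltr0n; have := order_le_size G; case: (size_of G) (ltnW n1) => // /ltn_geF ->.
have c0 : 0 < c by rewrite sqrtr_gt0 divr_gt0.
have cE : c ^+ 2 = n / m by rewrite sqr_sqrtr // divr_ge0 // ltW.
have W1 : 1 <= W by rewrite le_max lexx.
have L0 : 0 <= L := le_trans ler01 L1; have W0 : 0 <= W := le_trans ler01 W1.
have Lk0 k : 0 <= L ^+ k by rewrite exprn_ge0.
have wW : eps^-1 * c <= W by rewrite le_max lexx orbT.
pose B : R := c2 + `|K2| * L ^+ k2; pose Q : R := 1 + `|K2| * L ^+ k2 / c1.
have KL0 : 0 <= `|K2| * L ^+ k2 by rewrite mulr_ge0.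
have pmB (s : G) : (@pm G alpha s eps).2%:R <= `|K2| * L ^+ k2 * n ^+ 2.
  apply: le_trans (pm_le G s eps eps0) _; apply: le_trans (soft_bound_le _ _ _ n1) _.
  rewrite max_r // -/n exprn_ege1 // ler1n ltnW //.
have /andP[tau1 tau2] := tau_le (order_of G).
have guardB (s : G) : (tau (order_of G))%:R + (@pm G alpha s eps).2%:R <= B * n ^+ 2.
  by rewrite mulrDl lerD.
have guardQ (s : G) : (tau (order_of G))%:R + (@pm G alpha s eps).2%:R
    <= Q * (tau (order_of G))%:R.
  rewrite mulrDl mul1r lerD2l (le_trans (pmB s)) // -[leRHS]mulrA ler_wpM2l //.
  by rewrite ler_pdivlMl.
have Q1 : 1 <= Q by rewrite lerDl divr_ge0 // ltW.
have B0 : 0 <= B by rewrite addr_ge0 // ltW.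
have average (r : G -> R) : (forall s, (expected_time alpha P rbs pm tau pick eps s <= (r s)%:E)%E) ->
    (\sum_(s : G) (source_prob R s)%:E * expected_time alpha P rbs pm tau pick eps s
     <= (\sum_(s : G) source_prob R s * r s)%:E)%E.
  move=> le_r; rewrite -sumEFin; apply: lee_sum => s _.
  by rewrite (EFinM (source_prob R s)) lee_wpmul2l // lee_fin source_prob_ge0.
have BK : B * W <= K * L ^+ (k1 + k2 + 2) * W.
  apply: le_trans (polylog_collect k1 k2 L1 W1 (normr_ge0 K1) (normr_ge0 K2) c10 c20 M0).
  rewrite lerDr mulr_ge0 ?(le_trans ler01 Q1) //.
  apply: addr_ge0; apply: mulr_ge0 => //; first by rewrite mulr_ge0 // mulr_ge0.
  by rewrite mulr_ge0.
(* For [eps < n ^- 3], [c >= 1 / n] gives [c / eps >= n ^+ 2], so the safeguard ceiling suffices. *)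
have [eps_large|eps_small] := leP (n ^- 3) eps; last first.
  apply: le_trans (average (fun=> B * n ^+ 2) _) _ => [s|]; first exact: expected_time_guard.
  rewrite lee_fin -mulr_suml; apply: le_trans BK.
  apply: (@le_trans _ _ (B * n ^+ 2)).
    by rewrite ler_piMl ?sum_source_prob // mulr_ge0 // exprn_ge0 // ltW.
  rewrite ler_wpM2l // (le_trans _ wW) // mulrC ler_pdivlMr //.
  have cn : n^-1 <= c.
    rewrite -(@ler_pXn2r _ 2) ?nnegrE ?invr_ge0 ?(ltW n0) ?(ltW c0) // cE exprVn.
    rewrite ler_pdivlMr // ler_pdivrMl ?exprn_gt0 //.
    apply: (@le_trans _ _ (n ^+ 2 * 1)); first by rewrite mulr1 -natrX ler_nat size_le_square.
    by rewrite ler_wpM2l ?exprn_ge0 ?(ltW n0) // ler1n ltnW.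
  apply: le_trans cn; rewrite -ler_pdivlMl ?exprn_gt0 // -invfM.
  by rewrite mulrC -exprS (le_trans (ltW eps_small)).
(* [max 1 x] is relaxed to [1 + x], which makes the RBS bound affine in [inflow]; the 4 comes from
   the accuracy [eps * deg s / 4]. *)
pose e (s : G) := `|K1| * L ^+ k1 * (1 + 4 * (inflow alpha s / eps)).
(* One [z] serves all sources, so the per-source bound stays affine in [inflow]: it is
   [U + V * inflow] below. *)
pose z := eps^-1 * c; have z0 : 0 < z by rewrite mulr_gt0 ?invr_gt0.
have rbs_time_le s : (\int[P]_w ((phase1 alpha rbs eps s w).2%:R)%:E <= (e s)%:E)%E.
  have del0 : 0 < 4^-1 * eps * (deg s)%:R by rewrite !mulr_gt0 ?invr_gt0 // ltr0n deg_gt0.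
  apply: le_trans (rbs_le G s _ _ del0 _ (lexx _)) _.
    by rewrite invr_gt0 exprn_gt0 //= invf_lt1 ?exprn_gt0 // exprn_egt1 // ltr1n.
  rewrite lee_fin; apply: le_trans (soft_bound_le _ _ _ n1) _.
  rewrite ler_wpM2l ?mulr_ge0 ?exprn_ge0 ?(le_trans ler01 L1) //.
  have -> : (order_of G)%:R * pagerank alpha s / (4^-1 * eps * (deg s)%:R) =
      4 * (inflow alpha s / eps).
    rewrite /pagerank /inflow -/n; have ds0 : 0 < (deg s)%:R :> R by rewrite ltr0n deg_gt0.
    by field; rewrite !gt_eqF.
  by rewrite ge_max lerDl lerDr ler01 mulr_ge0 // divr_ge0 ?inflow_ge0 // ltW.
pose r s := Q * (2 * e s + 110 * L * (source_budget alpha eps s z + 1)) + B.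
apply: le_trans (average r _) _ => [s|]; first exact: expected_time_le.
rewrite lee_fin {}/r.
pose X := `|K1| * L ^+ k1.
pose U := Q * (2 * X + 110 * L * (z / 2 + 1)) + B.
pose V := Q * (8 * X / eps + 110 * L * ((3 + 36 / alpha) / eps + 252 * L / alpha ^+ 2 / (eps ^+ 2 * z))).
have X0 : 0 <= X by rewrite mulr_ge0.
have U0 : 0 <= U.
  apply: addr_ge0 => //; apply: mulr_ge0; first exact: le_trans Q1.
  apply: addr_ge0; apply: mulr_ge0 => //; first by rewrite mulr_ge0.
  by rewrite addr_ge0 // divr_ge0 // ltW.
apply: (@le_trans _ _ (U + V * (c ^+ 2 / 2))).
  have -> : \sum_(s : G) source_prob R s *
      (Q * (2 * e s + 110 * L * (source_budget alpha eps s z + 1)) + B) =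
      U * (\sum_(s : G) source_prob R s) + V * (\sum_(s : G) source_prob R s * inflow alpha s).
    rewrite !mulr_sumr -big_split /=; apply: eq_bigr => s _.
    by rewrite /e /source_budget -/n -/L -/X /U /V; ring.
  rewrite sum_source_inflow // cE lerD //; first by rewrite ler_piMr // sum_source_prob.
  rewrite -/n -/m (_ : n / (2 * m) = n / m / 2) //.
  by field; rewrite gt_eqF.
apply: le_trans (polylog_collect k1 k2 L1 W1 (normr_ge0 K1) (normr_ge0 K2) c10 c20 M0).
rewrite -/Q -/X -/B.
(* From [n <= 2 * m]. *)
have c2' : 0 <= c <= 2.
  rewrite (ltW c0) /= -(@ler_pXn2r _ 2) ?nnegrE ?(ltW c0) // cE ler_pdivrMr //.
  have n2m : n <= 2 * m by rewrite -natrM ler_nat order_le_size.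
  by rewrite (le_trans n2m) // expr2; lra.
have zW : 0 <= z <= W by rewrite (ltW z0) wW.
have := averaged_work_le a0 X0 L1 W1 c2' zW; rewrite -(ler_pM2l (lt_le_trans ltr01 Q1)).
have BW : B <= B * W by rewrite ler_peMr.
have -> : U + V * (c ^+ 2 / 2) = Q * (2 * X + 110 * L * (z / 2 + 1) +
  (4 * X * (c * z) + 110 * L * ((3 + 36 / alpha) * (c * z) / 2 + 126 * L / alpha ^+ 2 * z))) + B.
  by rewrite /U /V /z; field; rewrite !gt_eqF.
move=> h; apply: lerD => //; apply: le_trans h _.
by rewrite /M le_eqVlt; apply/orP; left; apply/eqP; ring.
Qed.
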